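(* Let $d\geq 1$ and let $f:[0,4]\to\mathbb{R}$ be continuous on $[0,4]$ and such that $f+c$ is completely monotone on $(0,4]$ for some constant $c\in\mathbb{R}$. Let $\overline{\omega}_N\subset S^d$ be an $N$-point configuration which is either strongly $m$-sharp for some $m\ge1$ or antipodal and $m$-sharp for some $m\ge 1$. Then $$Q_f(\overline{\omega}_N;S^d)\le Q_f(\omega_N;S^d)$$ for every $N$-point configuration (multiset, points may repeat) $\omega_N\subset S^d$. If in addition $f+c$ is strictly completely monotone on $(0,4]$ for some constant $c$, and $\omega_N$ is an $N$-point multiset on $S^d$ for which equality holds, then $\omega_N$ is sharp (in particular consists of distinct points) and the set of dot products between distinct points of $\omega_N$ coincides with the set of dot products between distinct points of $\overline{\omega}_N$.
   Context: $S^d$ is the unit sphere in $\mathbb{R}^{d+1}$, $\sigma_d$ its normalized surface measure. For a multiset $\omega_N=\{\mathbf{x}_1,\dots,\mathbf{x}_N\}\subset S^d$, $p_f(\mathbf{x},\omega_N)=\sum_{i=1}^N f(|\mathbf{x}-\mathbf{x}_i|^2)$ and $Q_f(\omega_N;S^d)=\max_{\mathbf{x}\in S^d}p_f(\mathbf{x},\omega_N)$. A function $h$ is completely monotone on an interval $I$ if it is infinitely differentiable there and $(-1)^kh^{(k)}\ge0$ on $I$ for all $k\ge0$; strictly completely monotone if moreover $(-1)^kh^{(k)}>0$ in the interior of $I$ for all $k\ge 0$. A spherical $n$-design is a configuration with $\frac1N\sum_i p(\mathbf{x}_i)=\int_{S^d}p\,d\sigma_d$ for all polynomials $p$ of degree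 $\le n$. A configuration of $N$ distinct points is $m$-sharp if it is a spherical $(2m-1)$-design and exactly $m$ distinct dot products occur between distinct points; strongly $m$-sharp if moreover it is a spherical $2m$-design; sharp if it is $m$-sharp for some $m$; antipodal if it is closed under $\mathbf{x}\mapsto-\mathbf{x}$. *)

(* Defs.v *)
From HB Require Import structures.
From mathcomp Require Import all_boot all_order all_algebra.
From mathcomp Require Import all_classical all_reals all_analysis.
Set Implicit Arguments.
Unset Strict Implicit.
Unset Printing Implicit Defensive.
Import Order.TTheory GRing.Theory Num.Theory.
Import numFieldNormedType.Exports.
Local Open Scope classical_set_scope.
Local Open Scope ring_scope.

Section Defs.
Context {R : realType}.

Definition dotp {n : nat} (x y : 'rV[R]_n) : R := \sum_i x 0 i * y 0 i.
Definition enorm {n : nat} (x : 'rV[R]_n) : R := Num.sqrt (dotp x x).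
Definition sqdist {n : nat} (x y : 'rV[R]_n) : R := dotp (x - y) (x - y).

Definition sphere (d : nat) : set 'rV[R]_d.+1 := [set x | dotp x x = 1].

Fixpoint iterint (k : nat) (g : seq R -> R) : R :=
  match k with
  | 0%N => g [::]
  | k'.+1 => \int[lebesgue_measure]_(t in setT) iterint k' (fun s => g (t :: s))
  end.

Definition vec_of_seq (n : nat) (s : seq R) : 'rV[R]_n := \row_i nth 0 s i.

Definition lebint (n : nat) (G : 'rV[R]_n -> R) : R :=
  iterint n (fun s => G (vec_of_seq n s)).

Definition unit_ball_ind (n : nat) (x : 'rV[R]_n) : R :=
  if enorm x <= 1 then 1 else 0.

(* integral of F against the normalized surface measure sigma_d on S^d,
   via the cone construction:
   sigma_d(A) = lambda_{d+1}({r a : 0 < r <= 1, a in A}) / lambda_{d+1}(B^{d+1}) *)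
Definition sphere_int (d : nat) (F : 'rV[R]_d.+1 -> R) : R :=
  lebint (fun x => unit_ball_ind x * F ((enorm x)^-1 *: x))
  / lebint (@unit_ball_ind d.+1).

Definition polyfun_le (n k : nat) (p : 'rV[R]_n -> R) : Prop :=
  exists s : seq (R * {ffun 'I_n -> nat}),
    all (fun c : R * {ffun 'I_n -> nat} => (\sum_i c.2 i <= k)%N) s /\
    forall x, p x = \sum_(c <- s) c.1 * \prod_i x 0 i ^+ c.2 i.

(* configurations: N-point multisets on S^d, as maps 'I_N -> R^(d+1) *)
Definition config_on_sphere (d N : nat) (w : 'I_N -> 'rV[R]_d.+1) : Prop :=
  forall i, @sphere d (w i).

Definition spherical_design (d N n : nat) (w : 'I_N -> 'rV[R]_d.+1) : Prop :=
  forall p, polyfun_le n p ->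
    (N%:R)^-1 * (\sum_i p (w i)) = sphere_int p.

Definition dot_products (d N : nat) (w : 'I_N -> 'rV[R]_d.+1) : seq R :=
  undup [seq dotp (w q.1) (w q.2) | q <- enum [set: 'I_N * 'I_N] & q.1 != q.2].

Definition m_sharp (d N m : nat) (w : 'I_N -> 'rV[R]_d.+1) : Prop :=
  injective w /\ spherical_design (2 * m - 1) w /\ size (dot_products w) = m.

Definition strongly_m_sharp (d N m : nat) (w : 'I_N -> 'rV[R]_d.+1) : Prop :=
  m_sharp m w /\ spherical_design (2 * m) w.

Definition sharp (d N : nat) (w : 'I_N -> 'rV[R]_d.+1) : Prop :=
  exists m, m_sharp m w.

Definition antipodal (d N : nat) (w : 'I_N -> 'rV[R]_d.+1) : Prop :=
  forall i, exists j, w j = - w i.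

Definition pot (d N : nat) (f : R -> R) (w : 'I_N -> 'rV[R]_d.+1) (x : 'rV[R]_d.+1) : R :=
  \sum_i f (sqdist x (w i)).

Definition Qf (d N : nat) (f : R -> R) (w : 'I_N -> 'rV[R]_d.+1) : R :=
  sup (pot f w @` @sphere d).

Definition completely_monotone_oc (h : R -> R) (a b : R) : Prop :=
  {within `]a, b], continuous h} /\
  forall k : nat, forall x, a < x < b ->
    derivable (derive1n k h) x 1 /\ 0 <= (-1) ^+ k * derive1n k h x.

Definition strictly_completely_monotone_oc (h : R -> R) (a b : R) : Prop :=
  completely_monotone_oc h a b /\
  forall k : nat, forall x, a < x < b -> 0 < (-1) ^+ k * derive1n k h x.

End Defs.
Arguments sphere {R} d _.

(* Main.v *)
Require Import Defs.
From HB Require Import structures.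
From mathcomp Require Import all_boot all_order all_algebra.
From mathcomp Require Import all_classical all_reals all_analysis.
From mathcomp Require Import measurable_realfun polyrcf ring lra zify.
Set Implicit Arguments.
Unset Strict Implicit.
Unset Printing Implicit Defensive.
Import Order.TTheory GRing.Theory Num.Theory.
Import numFieldNormedType.Exports.
Local Open Scope classical_set_scope.
Local Open Scope ring_scope.

(* With h(t) = f(2 - 2t), the maximum of the potential of a configuration is at
   least its average over the points of the configuration, which is the energy
   sum of h(x_i . x_j) (diagonal included) divided by N. For the sharp
   configuration this is an equality: the Hermite interpolant of h at the dot
   products t_i (double, except at -1) and at 1 (simple) lies above h on [-1, 1]
   and its potential is constant by the design property. It remains to see that
   the sharp configuration minimizes the energy (Cohn-Kumar): the Hermite
   interpolant at the t_i without 1 lies below h, and it is, up to a constant, a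
   nonnegative combination of products of the polynomials prod_(i <= j) (t - t_i)
   over the t_i other than -1, so it suffices that the latter are positive definite kernels. They are
   nonnegative combinations of the orthogonal polynomials of the distribution of
   the dot products, and these are positive definite by a Funk-Hecke formula in
   which the design itself plays the role of the surface measure. The node -1 is
   used only once and last, so that no kernel of degree above half the design
   strength is needed. The surface measure enters only through the rotation
   invariance of the moments of x . y. *)

(** * Orthogonal polynomials of a discrete measure *)

(** The argument rests on a count. Let [S] be the number of Hermite conditions: two for each dot
    product other than -1, one for -1. Without -1 a strongly m-sharp configuration has [S = 2m];
    with -1 one has [S = 2m - 1]. So the design strength is always at least [S]. The lower
    interpolant has degree below [S], the upper one, with the extra node 1, degree at most [S]. A
    double node at 1 is excluded because f is only continuous at 0. Only derivatives of positive
    order enter, which makes the additive constant harmless: a constant has the same energy for all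
    configurations. In the equality case every term of a sum of nonnegative terms vanishes: the dot
    products of the other configuration are nodes, and its moments of degree below [S] agree with
    those of the sharp one. When [S = 2m - 1], antipodality supplies the missing odd degree. *)

Section orthogonal.
Context {R : rcfType}.
Implicit Types (p q r P Q : {poly R}) (s : seq R) (k n : nat) (lam : R -> R).

Lemma size_monicB k P Q : P \is monic -> Q \is monic -> size P = k.+1 -> size Q = k.+1 ->
  (size (P - Q)%R <= k)%N.
Proof.
move=> /monicP mP /monicP mQ sP sQ; apply/leq_sizeP => j; rewrite coefB leq_eqVlt.
case/predU1P=> [<-|kj]; last by rewrite !nth_default ?subrr // ?sP ?sQ.
by move: mP mQ; rewrite /lead_coef sP sQ /= => -> ->; rewrite subrr.
Qed.

Lemma monic_basis (P : nat -> {poly R}) k :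
  (forall i, (i < k)%N -> P i \is monic /\ size (P i) = i.+1) ->
  forall r, (size r <= k)%N -> exists c : nat -> R, r = \sum_(i < k) c i *: P i.
Proof.
elim: k => [|k IH] hP r hr.
  by exists (fun=> 0); rewrite big_ord0; apply/eqP; rewrite -size_poly_leq0.
have [mP sP] := hP k (ltnSn k).
have sr' : (size (r - r`_k *: P k)%R <= k)%N.
  apply/leq_sizeP => j; rewrite coefB coefZ leq_eqVlt => /predU1P[<-|kj].
    by move: mP; rewrite monicE /lead_coef sP /= => /eqP ->; rewrite mulr1 subrr.
  by rewrite (@nth_default _ 0 r j) ?(leq_trans hr) // (@nth_default _ 0 (P k) j) ?sP // mulr0 subrr.
have [c cE] := IH (fun i ik => hP i (ltnW ik)) _ sr'.
exists (fun i => if i == k then r`_k else c i).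
rewrite big_ord_recr /= eqxx -[LHS](subrK (r`_k *: P k)) cE; congr (_ + _).
by apply: eq_bigr => i _; rewrite (ltn_eqF (ltn_ord i)).
Qed.

Definition wsum lam s p : R := \sum_(t <- s) lam t * p.[t].

Lemma wsumD lam s p q : wsum lam s (p + q) = wsum lam s p + wsum lam s q.
Proof. by rewrite /wsum -big_split; apply: eq_bigr => t _; rewrite hornerD mulrDr. Qed.

Lemma wsumZ lam s c p : wsum lam s (c *: p) = c * wsum lam s p.
Proof. by rewrite /wsum mulr_sumr; apply: eq_bigr => t _; rewrite hornerZ mulrCA. Qed.

Lemma wsumN lam s p : wsum lam s (- p) = - wsum lam s p.
Proof. by rewrite -scaleN1r wsumZ mulN1r. Qed.

Lemma wsumB lam s p q : wsum lam s (p - q) = wsum lam s p - wsum lam s q.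
Proof. by rewrite wsumD wsumN. Qed.

Lemma wsum0 lam s : wsum lam s 0 = 0.
Proof. by rewrite -(scale0r 0) wsumZ mul0r. Qed.

Lemma wsum_sum lam s n (F : 'I_n -> {poly R}) :
  wsum lam s (\sum_i F i) = \sum_i wsum lam s (F i).
Proof. exact: (big_morph _ (wsumD lam s) (wsum0 lam s)). Qed.

Lemma wsum_sqr_ge0 lam s p : (forall t, t \in s -> 0 < lam t) -> 0 <= wsum lam s (p * p).
Proof.
move=> l0; rewrite /wsum big_seq sumr_ge0 // => t /l0 t0.
by rewrite hornerM -expr2 mulr_ge0 ?sqr_ge0 // ltW.
Qed.

(** The form is definite only on polynomials of size at most the number of nodes, where vanishing at
    all nodes forces zero; this is the source of the size bounds below. *)
Lemma wsum_sqr_eq0 lam s p : uniq s -> (forall t, t \in s -> 0 < lam t) ->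
  (size p <= size s)%N -> wsum lam s (p * p) = 0 -> p = 0.
Proof.
move=> us l0 sp /eqP; rewrite /wsum big_seq psumr_eq0; last first.
  by move=> t /l0 t0; rewrite hornerM -expr2 mulr_ge0 ?sqr_ge0 // ltW.
move=> /allP h; apply: (roots_geq_poly_eq0 (rs := s)) => //.
apply/allP => t ts; have := h t ts; rewrite ts /= hornerM mulf_eq0 (gt_eqF (l0 _ ts)) /=.
by rewrite mulf_eq0 orbb.
Qed.

Lemma wsum_sqr_gt0 lam s p : uniq s -> (forall t, t \in s -> 0 < lam t) ->
  (size p <= size s)%N -> p != 0 -> 0 < wsum lam s (p * p).
Proof.
move=> us l0 sp p0; rewrite lt_def wsum_sqr_ge0 // andbT.
by apply: contra_neq p0; apply: wsum_sqr_eq0.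
Qed.

Definition monic_orthogonal (L : {poly R} -> R) k P :=
  [/\ P \is monic, size P = k.+1 & forall r, (size r <= k)%N -> L (P * r) = 0].

(** Gram-Schmidt on the powers of ['X]; the norms stay nonzero while the degree is below the number
    of nodes. *)
Lemma monic_orthogonal_family lam s K : uniq s -> (forall t, t \in s -> 0 < lam t) ->
  (K <= size s)%N ->
  exists P : nat -> {poly R}, forall i, (i < K)%N -> monic_orthogonal (wsum lam s) i (P i).
Proof.
move=> us l0; elim: K => [|K IH] Ks; first by exists (fun=> 0).
have [P hP] := IH (ltnW Ks).
have P0 i : (i < K)%N -> wsum lam s (P i * P i) != 0.
  move=> iK; have [mP sP _] := hP i iK; rewrite gt_eqF // wsum_sqr_gt0 //.
    by rewrite sP (leq_trans iK) // ltnW.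
  exact: monic_neq0.
pose c i := wsum lam s ('X^K * P i) / wsum lam s (P i * P i).
pose Q := 'X^K - \sum_(i < K) c i *: P i.
have sS : (size (\sum_(i < K) c i *: P i)%R <= K)%N.
  apply: (leq_trans (size_sum _ _ _)); apply/bigmax_leqP => i _.
  have [_ sP _] := hP i (ltn_ord i).
  by rewrite (leq_trans (size_scale_leq _ _)) // sP ltn_ord.
have sQ : size Q = K.+1 by rewrite /Q size_polyDl ?size_polyXn // size_polyN ltnS.
have mQ : Q \is monic.
  by rewrite monicE /Q lead_coefDl ?lead_coefXn // size_polyXn size_polyN ltnS.
exists (fun i => if i == K then Q else P i) => i; rewrite ltnS leq_eqVlt.
case/predU1P => [->|iK]; last by rewrite (ltn_eqF iK); apply: hP.
rewrite eqxx; split => // r sr.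
have [d ->] := monic_basis (fun i iK => let: And3 a b _ := hP i iK in conj a b) sr.
rewrite mulr_sumr wsum_sum big1 // => j _.
rewrite -scalerAr wsumZ /Q mulrBl wsumB mulr_suml wsum_sum (bigD1 j) //= big1 ?addr0.
  by rewrite -scalerAl wsumZ /c divfK ?subrr ?mulr0 // P0.
move=> i' ij; rewrite -scalerAl wsumZ.
have [_ sPi oPi] := hP i' (ltn_ord i'); have [_ sPj oPj] := hP j (ltn_ord j).
have [lt|ge] := ltnP i' j; first by rewrite [P i' * _]mulrC oPj ?mulr0 // sPi.
by rewrite oPi ?mulr0 // sPj ltn_neqAle ge andbT eq_sym.
Qed.

(** The difference has lower degree than both, so it is orthogonal to both and hence to itself. *)
Lemma monic_orthogonal_uniq lam s k P Q : uniq s -> (forall t, t \in s -> 0 < lam t) ->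
  (k <= size s)%N -> monic_orthogonal (wsum lam s) k P -> monic_orthogonal (wsum lam s) k Q ->
  P = Q.
Proof.
move=> us l0 ks [mP sP oP] [mQ sQ oQ]; apply/eqP; rewrite -subr_eq0; apply/eqP.
have sB := size_monicB mP mQ sP sQ.
apply: (wsum_sqr_eq0 us l0); first exact: leq_trans ks.
by rewrite mulrBl wsumB oP // oQ // subrr.
Qed.

(* If [P.[a] <= 0] then [P] has a root [r >= a], and pairing [P] with [P / (X - r)]
   contradicts orthogonality. *)
Lemma monic_orthogonal_last_gt0 lam s a k P : pairwise <%R (rcons s a) ->
  (forall t, t \in rcons s a -> 0 < lam t) -> (k <= size s)%N ->
  monic_orthogonal (wsum lam (rcons s a)) k P -> 0 < P.[a].
Proof.
move=> pw l0 ks [mP sP oP]; rewrite ltNge; apply/negP => Pa.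
have us : uniq (rcons s a) by apply: pairwise_uniq pw; exact: ltxx.
have [b hb] : exists b, forall x, b <= x -> 1 <= P.[x].
  have := @poly_pinfty_gt_lc R P; rewrite (monicP mP) => /(_ ltr01) [b hb].
  by exists b.
have Pb : 0 <= P.[Num.max a b] by rewrite (le_trans ler01) // hb // le_max lexx orbT.
have aM : a <= Num.max a b by rewrite le_max lexx.
have PaM : P.[a] <= 0 <= P.[Num.max a b] by rewrite Pa.
have [r /andP[ar _] /factor_theorem[q Pq]] := poly_ivt aM PaM.
have q0 : q != 0 by apply: contraTneq mP => q0; rewrite Pq q0 mul0r monicE lead_coef0 eq_sym oner_eq0.
have sq : size q = k by move: sP; rewrite Pq size_mul ?polyXsubC_eq0 // size_XsubC addn2 /= => -[].
have := oP q; rewrite sq leqnn => /(_ isT) /eqP.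
rewrite -oppr_eq0 -wsumN /wsum big_seq psumr_eq0; last first.
  move=> t /[dup] ts /l0 t0; rewrite mulr_ge0 ?(ltW t0) // Pq hornerN !hornerM hornerXsubC.
  rewrite mulrAC -expr2 -mulrN mulr_ge0 ?sqr_ge0 // oppr_ge0 subr_le0.
  move: ts; rewrite mem_rcons inE => /predU1P[->//|ts].
  move: pw; rewrite pairwise_rcons => /andP[/allP /(_ _ ts) ta _].
  exact: ltW (lt_le_trans ta ar).
move=> /allP h; move/eqP: q0; apply.
(* At [a] the factor [t - r] may vanish; the nodes of [s], all strictly below [r], still outnumber
   the degree of [q]. *)
apply: (roots_geq_poly_eq0 (rs := s)); last by rewrite sq.
  apply/allP => t ts; have ts' : t \in rcons s a by rewrite mem_rcons inE ts orbT.
  have := h t ts'; rewrite ts' /= Pq hornerN !hornerM hornerXsubC.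
  move: pw; rewrite pairwise_rcons => /andP[/allP /(_ _ ts) ta _].
  have tr : t - r != 0 by rewrite subr_eq0 lt_eqF // (lt_le_trans ta).
  rewrite mulf_eq0 (gt_eqF (l0 _ ts')) /= oppr_eq0 !mulf_eq0 (negPf tr) orbF orbb.
  by [].
by move: us; rewrite rcons_uniq => /andP[].
Qed.

(** A convex cone of polynomials, later the cone of positive definite kernels. *)
Variable K : {poly R} -> Prop.
Hypothesis K0 : K 0.
Hypothesis KD : forall p q, K p -> K q -> K (p + q).
Hypothesis KZ : forall (c : R) p, 0 <= c -> K p -> K (c *: p).

(** The coefficient of [r] along [P] is the pairing of [r] with [P] divided by the squared norm of
    [P], so nonnegative pairings suffice. *)
Lemma cone_expand lam s r : uniq s -> (forall t, t \in s -> 0 < lam t) ->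
  (size r <= size s)%N ->
  (forall j P, (j < size r)%N -> monic_orthogonal (wsum lam s) j P -> K P /\ 0 <= wsum lam s (r * P)) ->
  K r.
Proof.
move=> us l0 rs h.
have [P hP] := monic_orthogonal_family us l0 rs.
have [c rE] := monic_basis (fun i iK => let: And3 a b _ := hP i iK in conj a b) (leqnn (size r)).
rewrite rE; elim/big_ind: _ => // i _; have [KP rP] := h _ _ (ltn_ord i) (hP i (ltn_ord i)).
apply: KZ => //; move: rP.
have -> : wsum lam s (r * P i) = wsum lam s ((\sum_(i < size r) c i *: P i) * P i).
  by congr (wsum _ _ (_ * _)).
rewrite mulr_suml wsum_sum (bigD1 i) //= big1 ?addr0.
  have [mP sP _] := hP i (ltn_ord i).
  rewrite -scalerAl wsumZ pmulr_lge0 // wsum_sqr_gt0 // ?monic_neq0 //.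
  by rewrite sP (leq_trans (ltn_ord i)).
move=> j ji; rewrite -scalerAl wsumZ.
have [_ sPi oPi] := hP i (ltn_ord i); have [_ sPj oPj] := hP j (ltn_ord j).
rewrite -val_eqE /= in ji.
case: (ltngtP i j) ji => // ij _.
  by rewrite oPj ?mulr0 // sPi.
by rewrite [P j * _]mulrC oPi ?mulr0 // sPj.
Qed.

Definition prodXs s : {poly R} := \prod_(t <- s) ('X - t%:P).

Lemma size_prodXs s : size (prodXs s) = (size s).+1.
Proof. exact: size_prod_XsubC. Qed.

Lemma monic_prodXs s : prodXs s \is monic.
Proof. exact: monic_prod_XsubC. Qed.

Lemma root_prodXs s t : root (prodXs s) t = (t \in s).
Proof. exact: root_prod_XsubC. Qed.

Lemma horner_prodXs s x : (prodXs s).[x] = \prod_(t <- s) (x - t).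
Proof. by rewrite /prodXs horner_prod; apply: eq_bigr => t _; rewrite hornerXsubC. Qed.

(* The polynomials orthogonal for the weight [lam t * (a - t)] are nonnegative
   combinations of those orthogonal for [lam]: their coefficients are the
   values at [a], as in the Christoffel-Darboux kernel. *)
Lemma cone_drop_last lam s a k q : pairwise <%R (rcons s a) ->
  (forall t, t \in rcons s a -> 0 < lam t) -> (k <= size s)%N ->
  (forall j P, (j <= k)%N -> monic_orthogonal (wsum lam (rcons s a)) j P -> K P) ->
  monic_orthogonal (wsum (fun t => lam t * (a - t)) s) k q -> K q.
Proof.
move=> pw l0 ks KP [mq sq oq].
have us : uniq (rcons s a) by apply: pairwise_uniq pw; exact: ltxx.
set L := wsum lam (rcons s a) in KP *.
have LX (u : {poly R}) : (size u <= k)%N -> L (q * (u * ('X - a%:P))) = 0.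
  move=> su; rewrite /L /wsum big_rcons /=.
  rewrite !hornerM hornerXsubC subrr !mulr0 addr0.
  transitivity (- wsum (fun t => lam t * (a - t)) s (q * u)); last by rewrite oq // oppr0.
  rewrite /wsum -sumrN; apply: eq_bigr => t _.
  by rewrite !hornerM hornerXsubC; ring.
(* [P - P.[a]] is a multiple of ['X - a], and pairing [q] with such a multiple is, up to sign,
   pairing for the modified weight. *)
have LP j P : (j <= k)%N -> monic_orthogonal L j P -> L (q * P) = P.[a] * L q.
  move=> jk [mP sP _].
  have /factor_theorem[u uE] : root (P - P.[a]%:P) a by rewrite rootE hornerD hornerN hornerC subrr.
  have -> : P = u * ('X - a%:P) + P.[a]%:P by rewrite -uE subrK.
  have su : (size u <= k)%N.
    have [->|u0] := eqVneq u 0; first by rewrite size_poly0.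
    have : (size (u * ('X - a%:P))%R <= j.+1)%N.
      by rewrite -uE (leq_trans (size_polyD _ _)) // geq_max sP leqnn size_polyN size_polyC; case: (_ != _).
    rewrite size_mul ?polyXsubC_eq0 // size_XsubC addn2 /= ltnS => h; exact: leq_trans jk.
  rewrite mulrDr /L wsumD -/L LX // add0r hornerD hornerM hornerXsubC subrr mulr0 add0r hornerC.
  by rewrite mulrC mul_polyC /L wsumZ.
(* Tested against the orthogonal polynomial [P] of the same degree [k]: [q - P] has lower degree, so
   [L (q * P)] is the squared norm of [P]. *)
have kappa : 0 < L q.
  have kS : (k.+1 <= size (rcons s a))%N by rewrite size_rcons ltnS.
  have [F /(_ k (ltnSn k)) oP] := monic_orthogonal_family us l0 kS.
  move: (F k) oP => P oP; have [mP sP oP'] := oP.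
  have Pa := monic_orthogonal_last_gt0 pw l0 ks oP.
  rewrite -(pmulr_rgt0 _ Pa) -(LP k) //.
  have -> : q * P = (q - P) * P + P * P by ring.
  rewrite /L wsumD.
  rewrite [(q - P) * P]mulrC (oP' (q - P)); last exact: size_monicB.
  rewrite add0r.
  by rewrite wsum_sqr_gt0 // ?monic_neq0 // sP size_rcons ltnS.
apply: (cone_expand us l0); first by rewrite sq size_rcons ltnS.
rewrite sq => j P; rewrite ltnS => jk oP; split; first exact: KP oP.
rewrite -/L (LP j) // mulr_ge0 ?(ltW kappa) // ltW //.
exact: (monic_orthogonal_last_gt0 pw l0 (leq_trans jk ks) oP).
Qed.

(** Induction on the last node [a]. The product over all earlier nodes vanishes at every node but
    [a], so its pairings have the sign of values at [a]; shorter products are handled with the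
    weight [lam t * (a - t)] on the earlier nodes. *)
Lemma cone_partial_products lam s : pairwise <%R s -> (forall t, t \in s -> 0 < lam t) ->
  (forall k P, (k < size s)%N -> monic_orthogonal (wsum lam s) k P -> K P) ->
  forall j, (j < size s)%N -> K (prodXs (take j s)).
Proof.
elim/last_ind: s lam => [|s a IH] lam // pw l0 KP j.
rewrite size_rcons ltnS leq_eqVlt => /predU1P[->|js].
  rewrite -cats1 take_size_cat //.
  have us : uniq (rcons s a) by apply: pairwise_uniq pw; exact: ltxx.
  apply: (cone_expand us l0); first by rewrite size_prodXs size_rcons.
  rewrite size_prodXs => i P si oP; split; first by apply: KP oP; rewrite size_rcons.
  rewrite /wsum big_rcons /= big_seq big1 ?add0r; last first.
    by move=> t ts; rewrite hornerM; move: ts; rewrite -root_prodXs => /rootP ->; rewrite mul0r mulr0.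
  rewrite mulr_ge0 ?(ltW (l0 _ _)) ?mem_rcons ?inE ?eqxx // hornerM mulr_ge0 //.
    rewrite horner_prodXs big_seq prodr_ge0 // => t ts.
    move: pw; rewrite pairwise_rcons => /andP[/allP /(_ _ ts) ta _].
    by rewrite subr_ge0 ltW.
  by rewrite ltW // (monic_orthogonal_last_gt0 pw l0 _ oP).
rewrite -cats1 takel_cat; last exact: ltnW.
have ta t : t \in s -> t < a.
  by move=> ts; move: pw; rewrite pairwise_rcons => /andP[/allP /(_ _ ts)].
apply: (IH (fun t => lam t * (a - t))) => //.
- by move: pw; rewrite pairwise_rcons => /andP[].
- by move=> t ts; rewrite mulr_gt0 ?subr_gt0 ?ta // l0 // mem_rcons inE ts orbT.
- move=> k P ks oP; apply: (cone_drop_last pw l0 (ltnW ks)) oP => i Q ik.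
  by apply: KP; rewrite size_rcons ltnS (leq_trans ik) // ltnW.
Qed.

Lemma size_comp_opp p : size (p \Po - 'X) = size p.
Proof. by rewrite size_comp_poly2 // size_polyN size_polyX. Qed.

Lemma comp_oppK p : (p \Po - 'X) \Po - 'X = p.
Proof. by rewrite -comp_polyA rmorphN /= comp_polyX opprK comp_polyXr. Qed.

(** Reflecting [P] gives, up to sign, another monic orthogonal polynomial of the same degree, so
    uniqueness applies. *)
Lemma monic_orthogonal_parity lam s k P : uniq s -> (forall t, t \in s -> 0 < lam t) ->
  (k <= size s)%N -> (forall p, wsum lam s (p \Po - 'X) = wsum lam s p) ->
  monic_orthogonal (wsum lam s) k P -> P \Po - 'X = (-1) ^+ k *: P.
Proof.
move=> us l0 ks sym oP; have [mP sP oP'] := oP.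
suff oQ : monic_orthogonal (wsum lam s) k ((-1) ^+ k *: (P \Po - 'X)).
  by rewrite {2}(monic_orthogonal_uniq us l0 ks oP oQ) scalerA -expr2 sqrr_sign scale1r.
split.
- rewrite monicE lead_coefZ lead_coef_comp ?size_polyN ?size_polyX // lead_coefN lead_coefX.
  by rewrite (monicP mP) sP mul1r -expr2 sqrr_sign.
- by rewrite size_scale ?signr_eq0 // size_comp_opp.
- move=> r sr; rewrite -scalerAl wsumZ -[r]comp_oppK -comp_polyM sym oP' ?mulr0 //.
  by rewrite size_comp_opp.
Qed.

Lemma wsum_odd lam s p : (forall q, wsum lam s (q \Po - 'X) = wsum lam s q) ->
  p \Po - 'X = - p -> wsum lam s p = 0.
Proof. by move=> sym po; have := sym p; rewrite po wsumN; lra. Qed.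

(* Same mechanism as [cone_drop_last], with both endpoints [-1] and [1] dropped
   at once; by parity a single value [P.[1]] determines the coefficient. *)
Lemma cone_drop_ends lam s k q : pairwise <%R (-1 :: rcons s 1) ->
  (forall t, t \in -1 :: rcons s 1 -> 0 < lam t) ->
  (forall p, wsum lam (-1 :: rcons s 1) (p \Po - 'X) = wsum lam (-1 :: rcons s 1) p) ->
  (k <= size s)%N ->
  (forall j P, (j <= k)%N -> monic_orthogonal (wsum lam (-1 :: rcons s 1)) j P -> K P) ->
  monic_orthogonal (wsum (fun t => lam t * (1 - t ^+ 2)) s) k q -> K q.
Proof.
move=> pw l0 sym ks KP oq; have [mq sq oq'] := oq.
have us : uniq (-1 :: rcons s 1) by apply: pairwise_uniq pw; exact: ltxx.
set L := wsum lam (-1 :: rcons s 1) in KP sym *.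
set lam' := fun t => _ in oq oq'.
have pws : {in s, forall t, -1 < t < 1}.
  move=> t ts; move: pw => /=; rewrite pairwise_rcons => /and3P[/allP h1 /allP h2 _].
  by rewrite h1 ?h2 // mem_rcons inE ts orbT.
have l'0 t : t \in s -> 0 < lam' t.
  move=> ts; have /andP[h1 h2] := pws t ts.
  rewrite /lam' mulr_gt0 ?l0 ?inE ?mem_rcons ?inE ?ts ?orbT //.
  have -> : 1 - t ^+ 2 = (1 - t) * (t - (-1)) by ring.
  by rewrite mulr_gt0 // subr_gt0.
have us' : uniq s by move: us; rewrite /= rcons_uniq => /and3P[].
have LE p : L (p * (1 - 'X ^+ 2)) = wsum lam' s p.
  rewrite /L /wsum big_cons big_rcons /= !hornerE /= sqrrN expr1n subrr !mulr0 addr0 add0r.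
  by apply: eq_bigr => t _; rewrite !hornerE /lam' /=; ring.
have sym' p : wsum lam' s (p \Po - 'X) = wsum lam' s p.
  rewrite -!LE -[RHS]sym comp_polyM; congr (L (_ * _)).
  by rewrite rmorphB /= rmorphXn /= comp_polyX sqrrN comp_polyC.
have qpar := monic_orthogonal_parity us' l'0 ks sym' oq.
pose kap := L (q * (if odd k then 'X else 1)).
have LP j P : (j <= k)%N -> monic_orthogonal L j P ->
    L (q * P) = if odd j == odd k then P.[1] * kap else 0.
  move=> jk oP; have [mP sP _] := oP.
  have js : (j <= size (-1 :: rcons s 1)%R)%N by rewrite /= size_rcons (leq_trans jk) // (leq_trans ks) // !leqW.
  have Ppar := monic_orthogonal_parity us l0 js sym oP.
  case: ifPn => [/eqP jk2|jk2]; last first.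
    apply: (wsum_odd sym); rewrite comp_polyM qpar Ppar -scalerAl -scalerAr scalerA -exprD.
    by rewrite -signr_odd oddD; move: jk2; case: (odd j); case: (odd k) => //= _; rewrite expr1 scaleN1r.
  (* [Y] has the parity of [P] and the value 1 at 1, so [P - P.[1] *: Y] vanishes at 1 and, by
     parity, at -1. *)
  pose Y : {poly R} := if odd k then 'X else 1.
  have YE : Y.[-1] = (-1) ^+ j /\ Y.[1] = 1.
    by rewrite /Y -signr_odd jk2; case: (odd k); rewrite ?hornerX ?hornerC ?expr1 ?expr0.
  have P1E : P.[-1] = (-1) ^+ j * P.[1].
    by have := congr1 (fun p => p.[1]) Ppar; rewrite /= horner_comp hornerN hornerX hornerZ.
  have dv : Pdiv.Field.dvdp (('X - 1%:P) * ('X - (-1)%:P)) (P - P.[1] *: Y).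
    have ne : (-1 : R) != 1 by rewrite lt_eqF // (lt_trans (ltrN10 R)) // ltr01.
    rewrite Gauss_dvdp; last by rewrite coprimep_XsubC root_XsubC.
    rewrite !dvdp_XsubCl !rootE !hornerE /= YE.1 YE.2 P1E.
    by rewrite mulr1 subrr eqxx mulrC subrr eqxx.
  have [u uE] := dvdpP _ _ dv.
  have su : (size u <= k)%N.
    have [->|u0] := eqVneq u 0; first by rewrite size_poly0.
    have : (size (P - P.[1] *: Y)%R <= maxn j.+1 2)%N.
      rewrite (leq_trans (size_polyD _ _)) // geq_max sP leq_maxl /= size_polyN.
      rewrite (leq_trans (size_scale_leq _ _)) // /Y.
      by case: (odd k); rewrite ?size_polyX ?size_poly1 ?leq_maxr // leq_max orbT.
    rewrite uE size_mul ?mulf_neq0 ?polyXsubC_eq0 // size_mul ?polyXsubC_eq0 // !size_XsubC /=.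
    rewrite add0n !addnS addn0 /= leq_max !ltnS => /orP[h|]; first exact: leq_trans (ltnW h) jk.
    by rewrite leqn0 => /eqP ->.
  have -> : q * P = q * - u * (1 - 'X ^+ 2) + P.[1] *: (q * Y).
    rewrite scalerAr -mulrA -mulrDr; congr (_ * _).
    by rewrite -[LHS](subrK (P.[1] *: Y)) uE polyCN !polyC1; congr (_ + _); ring.
  by rewrite /L wsumD -/L LE oq' ?size_polyN // add0r /L wsumZ.
have Pgt0 j P : (j <= k)%N -> monic_orthogonal L j P -> 0 < P.[1].
  move=> jk oP; have := @monic_orthogonal_last_gt0 lam (-1 :: s) 1 j P; apply => //.
  by rewrite /= ltnW // ltnS (leq_trans jk).
have kappa : 0 < kap.
  have kS : (k.+1 <= size (-1 :: rcons s 1)%R)%N by rewrite /= size_rcons !ltnS leqW.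
  have [F /(_ k (ltnSn k)) oP] := monic_orthogonal_family us l0 kS.
  move: (F k) oP => P oP; have [mP sP oP'] := oP.
  have := LP k P (leqnn k) oP; rewrite eqxx => e.
  rewrite -(pmulr_rgt0 _ (Pgt0 k P (leqnn k) oP)) -e.
  have -> : q * P = (q - P) * P + P * P by ring.
  rewrite /L wsumD [(q - P) * P]mulrC (oP' (q - P)); last exact: size_monicB.
  by rewrite add0r wsum_sqr_gt0 // ?monic_neq0 // sP.
apply: (cone_expand us l0); first by rewrite sq /= size_rcons !ltnS leqW.
rewrite sq => j P; rewrite ltnS => jk oP; split; first exact: KP oP.
rewrite -/L (LP j) //; case: ifP => // _.
by rewrite mulr_ge0 ?(ltW kappa) // ltW // (Pgt0 j).
Qed.

(** Dropping both ends at once keeps the degrees of the orthogonal polynomials at most [size s]. The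
    full product over [s] vanishes at every node of the modified weight, so it is itself orthogonal
    for it. *)
Lemma cone_partial_products_symmetric lam s : pairwise <%R (-1 :: rcons s 1) ->
  (forall t, t \in -1 :: rcons s 1 -> 0 < lam t) ->
  (forall p, wsum lam (-1 :: rcons s 1) (p \Po - 'X) = wsum lam (-1 :: rcons s 1) p) ->
  (forall k P, (k <= size s)%N -> monic_orthogonal (wsum lam (-1 :: rcons s 1)) k P -> K P) ->
  forall j, (j <= size s)%N -> K (prodXs (take j s)).
Proof.
move=> pw l0 sym KP j.
have drop k q ks := @cone_drop_ends lam s k q pw l0 sym ks
  (fun i P ik => KP i P (leq_trans ik ks)).
rewrite leq_eqVlt => /predU1P[->|js].
  rewrite take_size; apply: (drop (size s)) => //; split; rewrite ?monic_prodXs ?size_prodXs //.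
  move=> r _; rewrite /wsum big_seq big1 // => t ts.
  by rewrite hornerM; move: ts; rewrite -root_prodXs => /rootP ->; rewrite mul0r mulr0.
apply: (@cone_partial_products (fun t => lam t * (1 - t ^+ 2)) s) => //.
- by move: pw => /=; rewrite pairwise_rcons => /and3P[].
- move=> t ts; move: pw => /=; rewrite pairwise_rcons => /and3P[/allP h1 /allP h2 _].
  have tm : t \in rcons s 1 by rewrite mem_rcons inE ts orbT.
  rewrite mulr_gt0 ?l0 ?inE ?tm ?orbT //.
  have -> : 1 - t ^+ 2 = (1 - t) * (t - (-1)) by ring.
  by rewrite mulr_gt0 // subr_gt0 ?h2 ?h1.
- by move=> k P ks; apply: drop; apply: ltnW.
Qed.

End orthogonal.

(** * Hermite interpolation *)

Section rolle.
Context {R : realType}.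
Implicit Types (a b : R) (s D ts : seq R) (hs : nat -> R -> R) (p Q H : {poly R}).

Lemma path_lt_bounds (x : R) s y : path <%R x s -> y \in x :: s -> x <= y <= last x s.
Proof.
elim: s x y => [|z s IH] x y /=; first by rewrite inE => _ /eqP ->; rewrite lexx.
move=> /andP[xz ps]; rewrite inE => /predU1P[->|/(IH z y ps)/andP[zy ->]].
  rewrite lexx (le_trans (ltW xz)) //.
  by have /andP[] := IH z z ps (mem_head _ _).
by rewrite (le_trans (ltW xz)).
Qed.

Lemma within_continuous_sub (f : R -> R) a b c d : a <= c -> d <= b ->
  {within `[a, b], continuous f} -> {within `[c, d], continuous f}.
Proof.
move=> ac db; apply: continuous_subspaceW => x /=; rewrite !in_itv /= => /andP[cx xd].
by rewrite (le_trans ac cx) (le_trans xd db).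
Qed.

(** The zeros found lie strictly between consecutive points of the list, hence off the list; this
    lets [rolle_hermite] add them to the double zeros. *)
Lemma rolle_between (f f' : R -> R) x s : path <%R x s ->
  {within `[x, last x s], continuous f} ->
  (forall y, x < y < last x s -> is_derive y 1 f (f' y)) ->
  (forall y, y \in x :: s -> f y = 0) ->
  exists s', [/\ size s' = size s, uniq s',
    (forall y, y \in s' -> x < y < last x s /\ f' y = 0) &
    (forall y, y \in s' -> y \notin x :: s)].
Proof.
elim: s x => [|y t IH] x /=; first by exists [::].
move=> /andP[xy pt] fc fd z0.
have /andP[_ yl] := path_lt_bounds pt (mem_head y t).
have [|||s' [ss us zs' ns']] := IH y pt.
- by apply: within_continuous_sub fc => //; exact: ltW.
- by move=> z /andP[yz zl]; apply: fd; rewrite (lt_trans xy).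
- by move=> z zt; apply: z0; rewrite inE zt orbT.
have fx : f x = 0 by apply: z0; rewrite mem_head.
have fy : f y = 0 by apply: z0; rewrite !inE eqxx orbT.
have fxy z : x < z < y -> is_derive z 1 f (f' z).
  by move=> /andP[xz zy]; apply: fd; rewrite xz /= (lt_le_trans zy).
have [c] : exists2 c, c \in `]x, y[%R & is_derive c 1 f 0.
  apply: Rolle => //; last by rewrite fx fy.
  - by move=> z; rewrite in_itv /= => /fxy fz; exact: (@ex_derive _ _ _ _ _ _ _ fz).
  - by apply: within_continuous_sub fc.
rewrite in_itv /= => cxy dc; have [xc cy] := andP cxy.
have f'c : f' c = 0.
  by rewrite -(@derive_val _ _ _ _ _ _ _ (fxy c cxy)) (@derive_val _ _ _ _ _ _ _ dc).
have gt_y z : z \in s' -> y < z by move=> /zs'[/andP[]].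
exists (c :: s'); split; rewrite /= ?ss //.
- by rewrite us andbT; apply/negP => /gt_y; rewrite ltNge (ltW cy).
- move=> z; rewrite inE => /predU1P[->|/zs'[/andP[yz ->] fz]].
    by rewrite xc (lt_le_trans cy).
  by rewrite (lt_trans xy).
- move=> z; rewrite inE => /predU1P[->|zs]; rewrite in_cons negb_or.
    rewrite (gt_eqF xc) /=; apply/negP => /(path_lt_bounds pt) /andP[+ _].
    by rewrite leNgt cy.
  by rewrite (gt_eqF (lt_trans xy (gt_y _ zs))) /= ns'.
Qed.

Lemma sorted_lt_exists s : uniq s -> exists s', [/\ sorted <%R s', size s' = size s & s' =i s].
Proof.
move=> us; exists (sort <=%R s); split; last exact: mem_sort.
- by rewrite sort_lt_sorted.
- exact: size_sort.
Qed.

(** Differentiability is asked only inside the interval: the function need not be differentiable at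
    the ends. *)
Definition derivatives_on a b hs := {within `[a, b], continuous (hs 0%N)} /\
  forall k x, a < x < b -> is_derive x 1 (hs k) (hs k.+1 x).

Section hermite.
Variables (a b : R).

Lemma rolle_iter hs j k s : derivatives_on a b hs -> uniq s -> size s = k.+1 ->
  (forall y, y \in s -> a < y < b /\ hs j y = 0) ->
  exists2 x, a < x < b & hs (j + k)%N x = 0.
Proof.
move=> [_ hd]; elim: k j s => [|k IH] j s us ss z0.
  case: s ss z0 {us} => [|x [|? ?]] //= _ /(_ x (mem_head _ _))[xab hx].
  by exists x; rewrite ?addn0.
have [u [pu su uE]] := sorted_lt_exists us; rewrite ss in su.
have uz y : y \in u -> a < y < b /\ hs j y = 0 by rewrite uE; apply: z0.
case: u pu su uz {uE} => [|x u] //= pu [su] uz.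
have [/andP[ax _] _] := uz x (mem_head _ _).
have [/andP[_ lb] _] := uz _ (mem_last x u).
have [||s' [ss' us' zs' _]] := rolle_between (f' := hs j.+1) pu _ _ (fun y yu => (uz y yu).2).
- apply: derivable_within_continuous => y; rewrite in_itv /= => /andP[xy yl].
  have yab : a < y < b by rewrite (lt_le_trans ax) //= (le_lt_trans yl).
  exact: (@ex_derive _ _ _ _ _ _ _ (hd j y yab)).
- by move=> y /andP[xy yl]; apply: hd; rewrite (lt_trans ax) //= (lt_trans yl).
rewrite addnS -addSn; apply: (IH _ s') => //; first by rewrite ss'.
move=> y /zs'[/andP[xy yl] hy]; split=> //.
by rewrite (lt_trans ax) //= (lt_trans yl).
Qed.

(** Rolle on [s] gives [size s - 1] new zeros of the derivative; with the [size D] old ones there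
    are [k + 1], all interior, and [rolle_iter] applies. *)
Lemma rolle_hermite hs s D k : derivatives_on a b hs -> uniq s -> uniq D ->
  {subset D <= s} -> (forall x, x \in s -> a <= x <= b /\ hs 0%N x = 0) ->
  (forall x, x \in D -> a < x < b /\ hs 1%N x = 0) ->
  (size s + size D = k.+2)%N -> exists2 x, a < x < b & hs k.+1 x = 0.
Proof.
move=> hD us uD Ds zs zD sz; have [hc hd] := hD.
have [u [pu su uE]] := sorted_lt_exists us.
case: u pu su uE => [|x u] pu su uE.
  have s0 : s = [::] by case: (s) su.
  case: D Ds {zD uD} sz => [|y D] Ds; first by rewrite s0.
  by have := Ds y (mem_head _ _); rewrite s0.
have uz y : y \in x :: u -> a <= y <= b /\ hs 0%N y = 0 by rewrite uE; apply: zs.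
have [/andP[ax _] _] := uz x (mem_head _ _).
have [/andP[_ lb] _] := uz _ (mem_last x u).
have [||s' [ss' us' zs' ns']] := rolle_between (f' := hs 1%N) pu _ _ (fun y yu => (uz y yu).2).
- exact: within_continuous_sub hc.
- by move=> y /andP[xy yl]; apply: hd; rewrite (le_lt_trans ax) //= (lt_le_trans yl).
rewrite -add1n; apply: (@rolle_iter hs 1 k (s' ++ D)) => //.
- rewrite cat_uniq us' uD andbT /=; apply/hasPn => y /Ds; rewrite -uE => yu.
  by apply/negP => /ns'; rewrite yu.
- by rewrite size_cat ss'; move: su sz => /= su; rewrite -su => -[].
- move=> y; rewrite mem_cat => /orP[/zs'[/andP[xy yl] hy]|]; last exact: zD.
  by rewrite (le_lt_trans ax) //= (lt_le_trans yl).
Qed.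

Definition interpolates hs Q s D :=
  (forall x, x \in s -> Q.[x] = hs 0%N x) /\ (forall x, x \in D -> Q^`().[x] = hs 1%N x).

Definition nodes_in s D := [/\ uniq s, uniq D, {subset D <= s},
  (forall x, x \in s -> a <= x <= b) & (forall x, x \in D -> a < x < b)].

(** Mean value form of a divided difference: the error has enough zeros for [rolle_hermite], and the
    derivative of [Q] of order [k + 1] is constant. This is how Newton coefficients inherit the
    signs of derivatives. *)
Lemma interpolates_lead hs Q s D k : derivatives_on a b hs -> nodes_in s D ->
  interpolates hs Q s D -> (size s + size D = k.+2)%N -> (size Q <= k.+2)%N ->
  exists2 x, a < x < b & hs k.+1 x = (k.+1)`!%:R * Q`_k.+1.
Proof.
move=> [hc hd] [us uD Ds sab Dab] [Qs QD] sz sQ.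
pose g j := hs j \- horner Q^`(j).
have gD : derivatives_on a b g.
  split.
    apply: within_continuousB => //; apply: continuous_subspaceT => x.
    exact: continuous_horner.
  move=> j x xab; have dx := hd j x xab.
  by rewrite /g derivnS; apply: is_deriveB; exact: is_derive_poly.
have [||x xab gx] := rolle_hermite gD us uD Ds _ _ sz.
- by move=> x xs; rewrite sab //; split=> //; rewrite /g /= Qs // subrr.
- by move=> x xD; rewrite Dab //; split=> //; rewrite /g /= QD // subrr.
exists x => //; move/eqP: gx; rewrite /g /= subr_eq0 => /eqP ->.
rewrite -derivnS.
have sQ' : (size Q^`(k.+1) <= 1)%N.
  apply/leq_sizeP => j j0; rewrite coef_derivn nth_default ?mul0rn //.
  by rewrite (leq_trans sQ) // addSn ltnS -{1}[k]addn0 ltn_add2l.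
by rewrite (size1_polyC sQ') hornerC coef_derivn addn0 ffactnn mulr_natl.
Qed.

Lemma horner_prodXs2_eq0 s D y : y \in s -> (prodXs s * prodXs D).[y] = 0.
Proof. by rewrite -root_prodXs hornerM => /rootP ->; rewrite mul0r. Qed.

Lemma horner_deriv_prodXs2_eq0 s D y : y \in s -> y \in D ->
  (prodXs s * prodXs D)^`().[y] = 0.
Proof.
rewrite -!root_prodXs derivM hornerD !hornerM => /rootP -> /rootP ->.
by rewrite mul0r mulr0 addr0.
Qed.

(** Newton's step: the nodal polynomial vanishes to the right order at the old nodes, so a multiple
    of it corrects the new value only. *)
Lemma interpolates_add_value hs H s D x :
  interpolates hs H s D -> nodes_in s D -> a <= x <= b -> x \notin s ->
  nodes_in (x :: s) D /\
  interpolates hs (H + ((hs 0%N x - H.[x]) / (prodXs s * prodXs D).[x]) *: (prodXs s * prodXs D))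
    (x :: s) D.
Proof.
move=> [Hs HD] [us uD Ds sab Dab] xab xs; split.
  split=> //=; first by rewrite xs.
  - by move=> y /Ds ys; rewrite inE ys orbT.
  - by move=> y; rewrite inE => /predU1P[->|/sab].
have W0 : (prodXs s * prodXs D).[x] != 0.
  rewrite hornerM mulf_neq0 // -?rootE ?root_prodXs //.
  by apply: contra xs; apply: Ds.
split=> y.
  rewrite inE => /predU1P[->|ys]; rewrite hornerD hornerZ.
    by rewrite divfK // addrC subrK.
  by rewrite (horner_prodXs2_eq0 _ ys) mulr0 addr0 Hs.
move=> yD; rewrite derivD derivZ hornerD hornerZ (horner_deriv_prodXs2_eq0 (Ds _ yD) yD).
by rewrite mulr0 addr0 HD.
Qed.

(** The nodal polynomial has a simple zero at [x], so a multiple of it can adjust the derivative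
    there. *)
Lemma interpolates_add_deriv hs H s D x : interpolates hs H s D -> nodes_in s D ->
  a < x < b -> x \in s -> x \notin D -> exists c,
  nodes_in s (x :: D) /\
  interpolates hs (H + c *: (prodXs s * prodXs D)) s (x :: D).
Proof.
move=> [Hs HD] [us uD Ds sab Dab] xab xs xD.
have Dx : (prodXs D).[x] != 0 by rewrite -rootE root_prodXs.
have sx : (prodXs s)^`().[x] != 0.
  have -> : prodXs s = ('X - x%:P) * prodXs (rem x s).
    by rewrite /prodXs (big_rem x xs).
  rewrite derivM derivXsubC mul1r hornerD hornerM hornerXsubC subrr mul0r addr0.
  by rewrite -rootE root_prodXs mem_rem_uniqF.
have W0 : (prodXs s * prodXs D)^`().[x] != 0.
  rewrite derivM hornerD !hornerM [X in _ + X * _](rootP _) ?root_prodXs //.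
  by rewrite mul0r addr0 mulf_neq0.
exists ((hs 1%N x - H^`().[x]) / (prodXs s * prodXs D)^`().[x]); split.
  split=> //=; first by rewrite xD.
  - by move=> y; rewrite inE => /predU1P[->//|/Ds].
  - by move=> y; rewrite inE => /predU1P[->//|/Dab].
split=> y.
  by move=> ys; rewrite hornerD hornerZ (horner_prodXs2_eq0 _ ys) mulr0 addr0 Hs.
rewrite inE derivD derivZ hornerD hornerZ => /predU1P[->|yD].
  by rewrite divfK // addrC subrK.
by rewrite (horner_deriv_prodXs2_eq0 (Ds _ yD) yD) mulr0 addr0 HD.
Qed.

Lemma lead_addZ H (c : R) W k : (size H <= k)%N -> W \is monic -> size W = k.+1 ->
  (H + c *: W)`_k = c /\ (size (H + c *: W)%R <= k.+1)%N.
Proof.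
move=> sH mW sW; split.
  rewrite coefD nth_default // add0r coefZ.
  by move: mW; rewrite monicE /lead_coef sW /= => /eqP ->; rewrite mulr1.
rewrite (leq_trans (size_polyD _ _)) // geq_max leqW //=.
by rewrite (leq_trans (size_scale_leq _ _)) // sW.
Qed.

Lemma monic_prodXs2 s D : (prodXs s * prodXs D : {poly R}) \is monic.
Proof. by rewrite rpredM ?monic_prodXs. Qed.

Lemma size_prodXs2 s D : size (prodXs s * prodXs D : {poly R}) = (size s + size D).+1.
Proof.
by rewrite size_mul ?monic_neq0 ?monic_prodXs // !size_prodXs addnS.
Qed.

(** Interpolating at [x] as well adds one Newton term, whose value at [x] is the error and whose
    coefficient is given by [interpolates_lead]. *)
Lemma interpolation_error hs H s D k x : derivatives_on a b hs -> nodes_in s D ->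
  interpolates hs H s D -> (size s + size D = k.+1)%N -> (size H <= k.+1)%N ->
  a <= x <= b -> x \notin s ->
  exists2 y, a < y < b & hs 0%N x - H.[x] = hs k.+1 y / (k.+1)`!%:R * (prodXs s * prodXs D).[x].
Proof.
move=> hD nsD iH sz sH xab xs.
have [nxD iH'] := interpolates_add_value iH nsD xab xs.
set c := (_ / _) in iH'.
have [cE sH'] := lead_addZ c sH (monic_prodXs2 s D) (etrans (size_prodXs2 s D) (congr1 S sz)).
have [|y yab hy] := interpolates_lead hD nxD iH' (k := k) _ sH'; first by rewrite /= addSn sz.
exists y => //; rewrite hy cE [_ * c]mulrC mulfK ?pnatr_eq0 -?lt0n ?fact_gt0 //.
rewrite /c divfK // hornerM mulf_neq0 // -?rootE ?root_prodXs //.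
by case: nsD => _ _ Ds _ _; apply: contra xs; apply: Ds.
Qed.

Lemma eq_interpolates hs H s s' D D' : perm_eq s s' -> perm_eq D D' ->
  interpolates hs H s D -> interpolates hs H s' D'.
Proof.
move=> ps pD [Hs HD]; split=> x.
  by rewrite -(perm_mem ps); apply: Hs.
by rewrite -(perm_mem pD); apply: HD.
Qed.

Lemma eq_nodes_in s s' D D' : perm_eq s s' -> perm_eq D D' -> nodes_in s D -> nodes_in s' D'.
Proof.
move=> ps pD [us uD Ds sab Dab]; split.
- by rewrite -(perm_uniq ps).
- by rewrite -(perm_uniq pD).
- by move=> x; rewrite -(perm_mem ps) -(perm_mem pD); apply: Ds.
- by move=> x; rewrite -(perm_mem ps); apply: sab.
- by move=> x; rewrite -(perm_mem pD); apply: Dab.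
Qed.

Lemma prodXs_rcons s (x : R) : prodXs (rcons s x) = prodXs (x :: s).
Proof. by apply: perm_big; rewrite perm_rcons. Qed.

(* The Newton basis for the nodes of [ts], each taken twice. *)
Definition newton_basis ts j : {poly R} := prodXs (take (uphalf j) ts) * prodXs (take j./2 ts).

Lemma newton_basisP ts j : (j <= (size ts).*2)%N ->
  newton_basis ts j \is monic /\ size (newton_basis ts j) = j.+1.
Proof.
move=> jt; split; first exact: monic_prodXs2.
have j2 : (j./2 <= size ts)%N by rewrite -[size ts]doubleK half_leq.
have ju : (uphalf j <= size ts)%N by rewrite leq_uphalf_double.
by rewrite size_prodXs2 !size_takel // addnC uphalf_half addnCA addnn odd_double_half.
Qed.

Lemma newton_basis_rcons s x j : (j <= (size s).*2)%N ->
  newton_basis (rcons s x) j = newton_basis s j.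
Proof.
move=> js; rewrite /newton_basis -cats1 !takel_cat //; last by rewrite leq_uphalf_double.
by rewrite -[size s]doubleK half_leq.
Qed.

Lemma size_newton_sum ts n (c : nat -> R) : (n <= (size ts).*2)%N ->
  (size (\sum_(j < n) c j *: newton_basis ts j)%R <= n)%N.
Proof.
move=> nt; apply: (leq_trans (size_sum _ _ _)); apply/bigmax_leqP => j _.
rewrite (leq_trans (size_scale_leq _ _)) // (newton_basisP _).2 //.
by rewrite (leq_trans _ nt) // ltnW.
Qed.

(** Each node is inserted twice in a row, for the value and then for the derivative; coefficient [j]
    is the leading coefficient of the interpolant of the first [j + 1] conditions. Index 0 is left
    out because the sign of a value is not controlled. *)
Lemma hermite_newton hs ts : derivatives_on a b hs -> uniq ts ->
  (forall x, x \in ts -> a < x < b) ->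
  exists c : nat -> R, [/\ nodes_in ts ts,
    interpolates hs (\sum_(j < (size ts).*2) c j *: newton_basis ts j) ts ts &
    forall j, (0 < j < (size ts).*2)%N -> exists2 y, a < y < b & hs j y = j`!%:R * c j].
Proof.
move=> hD; elim/last_ind: ts => [|s x IH] us sab.
  by exists (fun=> 0); split=> //= j; rewrite ltn0 andbF.
move: us; rewrite rcons_uniq => /andP[xs us].
have xab : a < x < b by apply: sab; rewrite mem_rcons mem_head.
have xab' : a <= x <= b by case/andP: xab => /ltW -> /ltW ->.
have [c [nd iH cP]] : exists c : nat -> R, [/\ nodes_in s s,
    interpolates hs (\sum_(j < (size s).*2) c j *: newton_basis s j) s s &
    forall j, (0 < j < (size s).*2)%N -> exists2 y, a < y < b & hs j y = j`!%:R * c j].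
  by apply: IH => // y ys; apply: sab; rewrite mem_rcons inE ys orbT.
set H := \sum_(j < _) _ in iH.
have sH : (size H <= (size s).*2)%N by exact: size_newton_sum.
have [nd1 iH1] := interpolates_add_value iH nd xab' xs.
set c1 := (_ / _) in iH1; set H1 := H + _ in iH1.
have [c2 [nd2]] := interpolates_add_deriv iH1 nd1 xab (mem_head _ _) xs.
set H2 := H1 + _ => iH2.
have [H1l sH1] := lead_addZ c1 sH (monic_prodXs2 s s) (etrans (size_prodXs2 s s) (congr1 S (addnn _))).
have sz2 : size (prodXs (x :: s) * prodXs s : {poly R}) = (size s).*2.+2.
  by rewrite size_prodXs2 /= addSn addnn.
have [H2l sH2] := lead_addZ c2 sH1 (monic_prodXs2 (x :: s) s) sz2.
have p1 : perm_eq (x :: s) (rcons s x) by rewrite perm_sym perm_rcons.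
exists (fun j => if (j < (size s).*2)%N then c j else if j == (size s).*2 then c1 else c2).
split; first exact: eq_nodes_in nd2.
  have -> : \sum_(j < (size (rcons s x)).*2) (if (j < (size s).*2)%N then c j else
     if (j : nat) == (size s).*2 then c1 else c2) *: newton_basis (rcons s x) j = H2.
    rewrite size_rcons doubleS !big_ord_recr /= ltnn eqxx ltnNge leqnSn /= -[X in _ == X]addn0 -addn1 eqn_add2l /=.
    congr (_ + _ *: _ + _ *: _).
    - by apply: eq_bigr => j _; rewrite ltn_ord newton_basis_rcons // ltnW.
    - by rewrite newton_basis_rcons // /newton_basis uphalf_double doubleK take_size.
    - rewrite /newton_basis addn1 /= uphalf_double doubleK.
      rewrite take_oversize ?size_rcons // prodXs_rcons -cats1 take_size_cat //.
  exact: eq_interpolates iH2.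
move=> j /andP[j0]; rewrite size_rcons doubleS ltnS leq_eqVlt ltnS leq_eqVlt.
case/orP => [/eqP jE|/orP[/eqP jE|js]]; last by rewrite js; apply: cP; rewrite j0.
  rewrite jE ltnNge leqnSn /= -[X in _ == X]addn0 -addn1 eqn_add2l /= addn1.
  by rewrite -H2l; apply: (interpolates_lead hD nd2 iH2) => //; rewrite /= addSn addnS addnn.
rewrite jE ltnn eqxx -H1l; move: j0 H1l sH1; rewrite jE.
have := addnn (size s); case: (_.*2) => // k kE _ H1l sH1.
by apply: (interpolates_lead hD nd1 iH1) => //; rewrite /= addSn kE.
Qed.

End hermite.
End rolle.

(** * Rotation invariance of the iterated integral *)

Section plane.
Context {R : realType}.
Local Notation mu := (@lebesgue_measure R).
Implicit Types (B M : R).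

Lemma integrable_bsupp (F : R -> R) B M : measurable_fun setT F ->
  (forall x, `|F x| <= M) -> (forall x, B < `|x| -> F x = 0) -> mu.-integrable setT (EFin \o F).
Proof.
move=> mF bF sF.
pose A : set R := `[-B, B]%classic.
have bd x : `|F x| <= M * \1_A x.
  rewrite indicE.
  have -> : (x \in A) = (`|x| <= B).
    by rewrite mem_setE in_itv /= ler_norml.
  by case: (lerP `|x| B) => h /=; [rewrite mulr1 bF|rewrite mulr0 sF // normr0].
apply: (@le_integrable _ _ _ mu setT measurableT (EFin \o F)
  (fun x => (M%:E * (EFin \o (\1_A : R -> R)) x)%E)).
- exact/measurable_EFinP.
- move=> x _ /=; rewrite lee_fin (le_trans (bd x)) // ler_norm //.
- by apply: integrableZl => //; apply: integrable_indic_itv.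
Qed.

Lemma Rintegral_shift (F : R -> R) (c B M : R) : measurable_fun setT F ->
  (forall x, `|F x| <= M) -> (forall x, B < `|x| -> F x = 0) ->
  \int[mu]_(x in setT) F (x + c) = \int[mu]_(x in setT) F x.
Proof.
move=> mF bF sF; pose sh : measurableTypeR R -> measurableTypeR R := fun x => (x : R) + c.
have mc : measurable_fun setT sh.
  by apply: measurable_funD.
have pf A : measurable A -> mu A = pushforward mu sh A.
  move=> mA; apply: lebesgue_measure_unique => //= _ [[a b]] _ <-.
  rewrite /pushforward.
  have -> : (sh @^-1` `]a, b]%classic) = `]a - c, b - c]%classic.
    by apply/seteqP; split=> x /=; rewrite !in_itv /= ltrBlDr lerBrDr.
  by rewrite !lebesgue_measure_itv /= !lte_fin ltrD2r -!EFinB opprB addrA subrK.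
rewrite /Rintegral; congr fine.
have ic : mu.-integrable setT ((EFin \o F) \o sh).
  apply: (@integrable_bsupp (fun x => F (x + c)) (B + `|c|) M) => //.
    exact: measurableT_comp.
  move=> x hx; apply: sF; have := ler_normB (x + c) c; rewrite addrK; lra.
transitivity (\int[pushforward mu sh]_(x in setT) (F x)%:E)%E.
  rewrite integral_pushforward //; exact/measurable_EFinP.
by apply: eq_measure_integral => A mA _; first [exact: pf | exact: (esym (pf _ mA))].
Qed.

(** A class on which Fubini holds and which is stable under shears and exchange of variables. [B]
    has no prescribed sign, whence [|B|] in the bounds below. *)
Definition bounded_supported2 B M (K : R -> R -> R) :=
  [/\ measurable_fun setT (fun z : R * R => K z.1 z.2),
   (forall x y, `|K x y| <= M), (forall x y, B < `|x| -> K x y = 0) &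
   (forall x y, B < `|y| -> K x y = 0)].

Lemma measurable_section1 B M K x : bounded_supported2 B M K -> measurable_fun setT (K x).
Proof.
move=> [mK _ _ _].
apply: (@measurableT_comp _ _ _ _ _ _ (fun z : R * R => K z.1 z.2) _ (fun y : R => (x, y)) mK).
by apply: measurable_fun_pair.
Qed.

Lemma bounded_supported2C B M K : bounded_supported2 B M K ->
  bounded_supported2 B M (fun x y => K y x).
Proof.
move=> [mK bK sK1 sK2]; split => //; last 2 first.
- by move=> x y; apply: sK2.
- by move=> x y; apply: sK1.
apply: (@measurableT_comp _ _ _ _ _ _ (fun z : R * R => K z.1 z.2) _
  (fun z : R * R => (z.2, z.1)) mK).
by apply: measurable_fun_pair.
Qed.

Lemma Rintegral_swap B M K : bounded_supported2 B M K ->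
  \int[mu]_(x in setT) \int[mu]_(y in setT) K x y =
  \int[mu]_(y in setT) \int[mu]_(x in setT) K x y.
Proof.
move=> bK; have bKC := bounded_supported2C bK; have [mK MK s1 s2] := bK.
have intK1 x : mu.-integrable setT (EFin \o K x).
  apply: (@integrable_bsupp _ B M) => //; [exact: measurable_section1 bK|exact: s2].
have intK2 y : mu.-integrable setT (EFin \o (fun x => K x y)).
  apply: (@integrable_bsupp _ B M) => //; last by move=> x; apply: s1.
  exact: (@measurable_section1 _ _ (fun x y => K y x) _ bKC).
have ifK : (mu \x mu)%E.-integrable setT (fun z : R * R => (K z.1 z.2)%:E).
  pose A : set R := `[-B, B]%classic.
  have mA : measurable A by exact: measurable_itv.
  have AE x : (x \in A) = (`|x| <= B) by rewrite mem_setE in_itv /= ler_norml.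
  apply: (@le_integrable _ _ _ (mu \x mu)%E setT measurableT _
    (fun z => (M%:E * (\1_(A `*` A) z)%:E)%E)).
  - exact/measurable_EFinP.
  - case=> x1 x2 _ /=; rewrite lee_fin.
    rewrite (le_trans _ (ler_norm _)) // indicE in_setX !AE /=.
    case: (lerP `|x1| B) => hx /=; last by rewrite mulr0 s1 // normr0.
    by case: (lerP `|x2| B) => hy /=; [rewrite mulr1 MK|rewrite mulr0 s2 // normr0].
  apply: integrableZl => //.
  have mAA : measurable (A `*` A : set (measurableTypeR R * measurableTypeR R)) by exact: measurableX.
  apply/integrableP; split; first exact/measurable_EFinP/measurable_indic.
  under eq_integral => z _ do rewrite gee0_abs ?lee_fin ?indicE ?ler0n //.
  rewrite integral_indic //.
  rewrite setIT; apply: (@le_lt_trans _ _ (mu A * mu A)%E).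
    by rewrite le_eqVlt; apply/orP; left; apply/eqP; exact: product_measure1E.
  rewrite lte_mul_pinfty //.
  - by rewrite ge0_fin_numE // /A lebesgue_measure_itv /=; case: ifP => // _; rewrite -EFinB ltry.
  - by rewrite /A lebesgue_measure_itv /=; case: ifP => // _; rewrite -EFinB ltry.
rewrite /Rintegral; congr fine.
transitivity (\int[mu]_x \int[mu]_y (K x y)%:E)%E.
  apply: eq_integral => x _; rewrite fineK //.
  exact: (integrable_fin_num measurableT (intK1 x)).
transitivity (\int[mu]_y \int[mu]_x (K x y)%:E)%E.
  exact: (Fubini ifK).
apply: eq_integral => x _; rewrite fineK //.
exact: (integrable_fin_num measurableT (intK2 x)).
Qed.

Lemma bounded_supported2_shear B M K (c : R) : bounded_supported2 B M K ->
  bounded_supported2 (B + `|c| * `|B|) M (fun x y => K x (y + c * x)).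
Proof.
move=> [mK bK s1 s2].
have e0 : 0 <= `|c| * `|B| by rewrite mulr_ge0.
split => //.
- apply: (@measurableT_comp _ _ _ _ _ _ (fun z : R * R => K z.1 z.2) _
    (fun z : R * R => (z.1, z.2 + c * z.1)) mK).
  apply: measurable_fun_pair; first exact: measurable_fst.
  apply: measurable_funD; first exact: measurable_snd.
  by apply: measurable_funM => //; exact: measurable_fst.
- by move=> x y h; apply: s1; lra.
move=> x y h; case: (ltrP B `|x|) => hx; first exact: s1.
apply: s2; have := ler_normB (y + c * x) (c * x); rewrite addrK normrM => h1.
have : `|c| * `|x| <= `|c| * `|B| by rewrite ler_wpM2l // (le_trans hx) // ler_norm.
lra.
Qed.

Lemma Rintegral2_shear B M K c : bounded_supported2 B M K ->
  \int[mu]_(x in setT) \int[mu]_(y in setT) K x (y + c * x) =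
  \int[mu]_(x in setT) \int[mu]_(y in setT) K x y.
Proof.
move=> bK; apply: eq_Rintegral => x _.
have [_ MK s1 s2] := bK.
exact: (Rintegral_shift (c * x) (measurable_section1 x bK) (MK x) (s2 x)).
Qed.

Lemma Rintegral2_shearC B M K c : bounded_supported2 B M K ->
  \int[mu]_(x in setT) \int[mu]_(y in setT) K (x + c * y) y =
  \int[mu]_(x in setT) \int[mu]_(y in setT) K x y.
Proof.
move=> bK; have bKC := bounded_supported2C bK.
rewrite (Rintegral_swap bK) -(Rintegral2_shear c bKC).
exact: (Rintegral_swap (bounded_supported2C (bounded_supported2_shear c bKC))).
Qed.

(* For [s != 0] the rotation is a product of three shears, with [t := (c - 1) / s]:
   [x, y] is sent by [1 t; 0 1], [1 0; s 1], [1 t; 0 1]. *)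
Lemma Rintegral2_rot B M K c s : s != 0 -> c ^+ 2 + s ^+ 2 = 1 -> bounded_supported2 B M K ->
  \int[mu]_(x in setT) \int[mu]_(y in setT) K (c * x - s * y) (s * x + c * y) =
  \int[mu]_(x in setT) \int[mu]_(y in setT) K x y.
Proof.
move=> s0 cs bK; pose t := (c - 1) / s.
have ts : t * s = c - 1 by rewrite /t divfK.
have tt : t * (c + 1) = - s.
  apply: (mulfI s0); rewrite mulrA [s * t]mulrC ts.
  transitivity (c ^+ 2 - 1); first by ring.
  by rewrite -cs; ring.
pose K1 := fun x y => K (x + t * y) y.
pose K2 := fun x y => K1 x (y + s * x).
have bK1 := bounded_supported2C (bounded_supported2_shear t (bounded_supported2C bK)).
have bK2 := bounded_supported2_shear s bK1.
rewrite -(Rintegral2_shearC t bK) -(Rintegral2_shear s bK1) -(Rintegral2_shearC t bK2).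
apply: eq_Rintegral => x _; apply: eq_Rintegral => y _.
congr (K _ _).
- transitivity ((1 + t * s) * x + t * (c + 1) * y); last first.
    transitivity ((1 + t * s) * x + t * (2 + t * s) * y); last by ring.
    by rewrite ts; ring.
  by rewrite ts tt; ring.
- transitivity (s * x + (t * s + 1) * y); last by ring.
  by rewrite ts; ring.
Qed.
End plane.

(** * Coordinate rotations in iterated integrals *)

Section iterated.
Context {R : realType}.
Local Notation mu := (@lebesgue_measure R).
Implicit Types (g : seq R -> R).

(* Joint measurability of [g] on lists of length [n], tested by composing with
   all measurable [n]-tuples of real functions; this avoids a product
   sigma-algebra on lists. *)
Definition seq_measurable n g := forall (d : measure_display) (T : measurableType d)
    (us : seq (T -> R)), size us = n ->
  (forall i, measurable_fun setT (nth (cst 0) us i)) ->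
  measurable_fun setT (fun x => g [seq u x | u <- us]).

Definition seq_bounded_supported n g := [/\ seq_measurable n g,
  (exists M : R, forall s, size s = n -> `|g s| <= M) &
  (exists B : R, forall s i, size s = n -> (i < n)%N -> B < `|s`_i| -> g s = 0)].

Lemma seq_measurable_Rintegral k g : seq_measurable k.+1 g ->
  seq_measurable k (fun s => \int[mu]_(t in setT) g (rcons s t)).
Proof.
move=> mg d T us us_k mus.
pose G := fun z : T * measurableTypeR R => (g (rcons [seq u z.1 | u <- us] z.2))%:E.
have mG : measurable_fun setT G.
  apply/measurable_EFinP.
  pose us' : seq (T * measurableTypeR R -> R) := rcons [seq u \o fst | u <- us] snd.
  have -> : (fun z : T * measurableTypeR R => g (rcons [seq u z.1 | u <- us] z.2)) =
            (fun z => g [seq u z | u <- us']).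
    by apply/funext => z; rewrite map_rcons -map_comp.
  apply: mg; first by rewrite size_rcons size_map us_k.
  move=> i; rewrite nth_rcons size_map.
  case: ltnP => h.
    rewrite (nth_map (cst 0)) //.
    exact: (measurableT_comp (mus i) measurable_fst).
  by case: ifP => _; [exact: measurable_snd|exact: measurable_cst].
rewrite /Rintegral.
apply: (measurableT_comp (fine_measurable measurableT)).
have -> : (fun x => \int[mu]_t (g (rcons [seq u x | u <- us] t))%:E)%E =
  ((fun x => \int[mu]_t (G^\+ (x, t))) \- (fun x => \int[mu]_t (G^\- (x, t))))%E.
  apply/funext => x; rewrite [LHS]integralE.
  by congr (_ - _)%E; apply: eq_integral => t _; rewrite ?funeposE ?funenegE.
apply: emeasurable_funB.
- exact: (measurable_fun_fubini_tonelli_F _ (measurable_funepos mG)).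
- exact: (measurable_fun_fubini_tonelli_F _ (measurable_funeneg mG)).
Qed.

Lemma norm_Rintegral_le (F : R -> R) (B M : R) : measurable_fun setT F ->
  (forall x, `|F x| <= M) -> (forall x, B < `|x| -> F x = 0) ->
  `|\int[mu]_(x in setT) F x| <= M * (2 * `|B|).
Proof.
move=> mF bF sF.
have M0 : 0 <= M by apply: le_trans (bF 0).
pose A : set (measurableTypeR R) := `[-`|B|, `|B|]%classic.
have mA : measurable A by exact: measurable_itv.
have iF := integrable_bsupp mF bF sF.
rewrite (le_trans (le_normr_Rintegral measurableT iF)) //.
have -> : M * (2 * `|B|) = \int[mu]_(x in setT) (M * \1_A x).
  have iA : mu.-integrable setT (EFin \o (\1_A : _ -> R)) by apply: integrable_indic_itv.
  rewrite (RintegralZl _ measurableT iA); congr (_ * _).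
  have EI : (\int[mu]_x (\1_A x)%:E)%E = mu A by rewrite integral_indic // setIT.
  have EA : mu A = (if - `|B| < `|B| then `|B| + `|B| else 0)%:E.
    by rewrite /A lebesgue_measure_itv /= lte_fin -EFinB opprK; case: ifP.
  rewrite /Rintegral EI EA /=.
  by case: ltrP => h /=; have := normr_ge0 B; lra.
apply: le_Rintegral => //.
- exact: (integrable_norm iF).
- have iA : mu.-integrable setT (EFin \o (\1_A : _ -> R)) by apply: integrable_indic_itv.
  exact: (integrableZl measurableT M iA).
move=> x _; rewrite indicE.
have -> : (x \in A) = (`|(x : R)| <= `|B|) by rewrite mem_setE in_itv /= ler_norml.
case: (lerP `|(x : R)| `|B|) => h /=; first by rewrite mulr1 bF.
by rewrite mulr0 sF ?normr0 // (le_lt_trans _ h) // ler_norm.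
Qed.

Lemma seq_measurable_section k g s : seq_measurable k.+1 g -> size s = k ->
  measurable_fun setT (fun t => g (rcons s t)).
Proof.
move=> mg sk.
have -> : (fun t : R => g (rcons s t)) = (fun t : R => g [seq u t | u <- rcons [seq cst x | x <- s] id]).
  apply/funext => t; congr g; rewrite map_rcons -map_comp; congr rcons.
  by rewrite -[LHS]map_id; apply: eq_map.
apply: mg; first by rewrite size_rcons size_map sk.
move=> i; rewrite nth_rcons size_map; case: ltnP => h; last by case: ifP.
by rewrite (nth_map 0).
Qed.

Lemma seq_bounded_supported_Rintegral k g : seq_bounded_supported k.+1 g ->
  seq_bounded_supported k (fun s => \int[mu]_(t in setT) g (rcons s t)).
Proof.
move=> [mg [M bg] [B sg]]; split; first exact: seq_measurable_Rintegral.
- exists (M * (2 * `|B|)) => s sk; apply: (norm_Rintegral_le (B := B) (seq_measurable_section mg sk)).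
  + by move=> x; apply: bg; rewrite size_rcons sk.
  + move=> x hx; apply: (sg _ k); rewrite ?size_rcons ?sk //.
    by rewrite nth_rcons sk ltnn eqxx.
- exists B => s i sk ik hi.
  rewrite (@eq_Rintegral _ _ _ _ _ (cst 0)); first by rewrite Rintegral_cst // mul0r.
  move=> x _; apply: (sg _ i); rewrite ?size_rcons ?sk //; first exact: ltnW.
  by rewrite nth_rcons sk ik.
Qed.

(** The last [n] coordinates are integrated out from the right. With [k = 2] this reduces a rotation
    of the first two coordinates to the plane. *)
Lemma seq_bounded_supported_iterint n k g : seq_bounded_supported (k + n) g ->
  seq_bounded_supported k (fun s => iterint n (fun s' => g (s ++ s'))).
Proof.
elim: n k g => [|n IHn] k g /=.
  rewrite addn0 => -[mg [M bg] [B sg]]; split.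
  - move=> d T us us_k mus; under eq_fun do rewrite cats0; exact: mg.
  - by exists M => s sk; rewrite cats0; apply: bg.
  - by exists B => s i sk ik; rewrite cats0; apply: sg.
rewrite addnS -addSn => /IHn /seq_bounded_supported_Rintegral.
have -> // : (fun s => \int[mu]_(t in setT) iterint n (fun s' => g (rcons s t ++ s'))) =
  (fun s => \int[mu]_(t in setT) iterint n (fun s' => g (s ++ t :: s'))).
by apply/funext => s; apply: eq_Rintegral => t _; congr iterint; apply/funext => s'; rewrite cat_rcons.
Qed.

Lemma eq_iterint n g h : (forall s, size s = n -> g s = h s) -> iterint n g = iterint n h.
Proof.
elim: n g h => [|n IHn] g h gh /=; first exact: gh.
by apply: eq_Rintegral => t _; apply: IHn => s sn; apply: gh; rewrite /= sn.
Qed.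

(** Rotation in the plane of coordinates [p] and [p + 1]; adjacent pairs suffice to move a unit
    vector to the first axis. *)
Fixpoint givens (c s : R) (p : nat) (x : seq R) : seq R :=
  match p, x with
  | 0%N, a :: b :: x' => c * a - s * b :: s * a + c * b :: x'
  | p'.+1, a :: x' => a :: givens c s p' x'
  | _, _ => x
  end.

Lemma seq_bounded_supported_cons n g t : seq_bounded_supported n.+1 g ->
  seq_bounded_supported n (fun s => g (t :: s)).
Proof.
move=> [mg [M bg] [B sg]]; split.
- move=> d T us us_n mus; apply: (mg d T (cst t :: us)) => /=; first by rewrite us_n.
  by case=> [|i] /=.
- by exists M => s sn; apply: bg; rewrite /= sn.
- by exists B => s i sn i_n hi; apply: (sg _ i.+1); rewrite /= ?sn.
Qed.

Lemma iterint_givens c s p n g : s != 0 -> c ^+ 2 + s ^+ 2 = 1 -> (p.+1 < n)%N ->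
  seq_bounded_supported n g -> iterint n (g \o givens c s p) = iterint n g.
Proof.
move=> s0 cs; elim: p n g => [|p IHp] [|n] g //=.
  case: n => [|n] // _ /= bg.
  have := @seq_bounded_supported_iterint n 2 g bg.
  set K := (fun s => iterint n _) => -[mK [M bK] [B sK]].
  apply: (@Rintegral2_rot _ B M (fun a b => K [:: a; b])) => //; split.
  - apply: (mK _ _ [:: fst; snd]) => //.
    by case=> [|[|i]] /=; [exact: measurable_fst|exact: measurable_snd|rewrite nth_nil].
  - by move=> x y; apply: bK.
  - by move=> x y h; apply: (sK _ 0%N).
  - by move=> x y h; apply: (sK _ 1%N).
rewrite ltnS => pn bg; apply: eq_Rintegral => t _.
exact: (IHp _ (fun s => g (t :: s)) pn (seq_bounded_supported_cons t bg)).
Qed.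

End iterated.

(** * Rotation invariance of the moments of linear forms *)

Section moments.
Context {R : realType}.
Implicit Types (x y s : seq R).

Fixpoint sdot x y : R :=
  match x, y with a :: x', b :: y' => a * b + sdot x' y' | _, _ => 0 end.

Lemma sdotE n x y : size x = n -> size y = n -> sdot x y = \sum_(i < n) x`_i * y`_i.
Proof.
elim: n x y => [|n IH] [|a x] [|b y] //=; first by rewrite big_ord0.
by move=> [xn] [yn]; rewrite big_ord_recl /= (IH x y).
Qed.

Lemma size_givens (c s : R) p x : size (givens c s p x) = size x.
Proof. by elim: p x => [|p IH] [|a x] //=; [case: x|rewrite IH]. Qed.

Lemma sdot_givens (c s : R) p x y : (p.+1 < size x)%N -> size x = size y ->
  sdot x (givens c s p y) = sdot (givens c (- s) p x) y.
Proof.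
elim: p x y => [|p IH] [|a x] [|b y] //=.
  by case: x y => [|a' x] [|b' y] //= _ _; ring.
by rewrite ltnS => h [e]; rewrite IH.
Qed.

Lemma givensK (c s : R) p x : c ^+ 2 + s ^+ 2 = 1 -> givens c (- s) p (givens c s p x) = x.
Proof.
move=> cs; elim: p x => [|p IH] [|a x] //=; last by rewrite IH.
case: x => [|b x] //=; congr [:: _, _ & _].
  by transitivity ((c ^+ 2 + s ^+ 2) * a); [ring|rewrite cs mul1r].
by transitivity ((c ^+ 2 + s ^+ 2) * b); [ring|rewrite cs mul1r].
Qed.

Lemma sdot_givens2 (c s : R) p x : c ^+ 2 + s ^+ 2 = 1 -> (p.+1 < size x)%N ->
  sdot (givens c s p x) (givens c s p x) = sdot x x.
Proof. by move=> cs px; rewrite sdot_givens ?size_givens // givensK. Qed.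

Lemma nth_givens_gt (c s : R) p x i : (p.+1 < i)%N -> (givens c s p x)`_i = x`_i.
Proof.
elim: p x i => [|p IH] [|a x] [|i] //=; last by rewrite ltnS => /IH.
by case: x => [|b x] //=; case: i.
Qed.

Lemma nth_givensS (c s : R) p x : (p.+1 < size x)%N ->
  (givens c s p x)`_p.+1 = s * x`_p + c * x`_p.+1.
Proof.
elim: p x => [|p IH] [|a x] //=; first by case: x.
by rewrite ltnS => /IH.
Qed.

Section invariant.
Variables (n : nat) (J : seq R -> R).
Hypothesis n2 : (1 < n)%N.
Hypothesis JG : forall (c s : R) p x, s != 0 -> c ^+ 2 + s ^+ 2 = 1 -> (p.+1 < n)%N ->
  size x = n -> sdot x x = 1 -> J (givens c s p x) = J x.

(** The last nonzero coordinate is repeatedly rotated into its left neighbour until only the first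
    one, equal to 1 or -1, is left. *)
Lemma givens_invariant_const x : size x = n -> sdot x x = 1 -> J x = J (1 :: nseq n.-1 0).
Proof.
move=> xn x1.
suff H j : (j < n)%N -> forall x, size x = n -> sdot x x = 1 ->
    (forall i, (j < i)%N -> x`_i = 0) -> J x = J (1 :: nseq n.-1 0).
  apply: (H n.-1) => //; first by rewrite prednK // ltnW.
  by move=> i hi; rewrite nth_default // xn -(prednK (ltnW n2)).
elim: j => [|j IH] jn {xn x1}x xn x1 x0.
  have xE : x = x`_0 :: nseq n.-1 0.
    case: x xn {x1} x0 => [|a x] /=; first by move=> n0; move: n2; rewrite -n0.
    move=> xn x0; congr (_ :: _); apply: (@eq_from_nth _ 0).
      by rewrite size_nseq -xn.
    by move=> i _; rewrite nth_nseq if_same; apply: (x0 i.+1).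
  have d0 y k : sdot y (nseq k 0) = 0.
    by elim: k y => [|k IHk] [|b y] //=; rewrite mulr0 add0r IHk.
  have : x`_0 ^+ 2 = 1 by move: x1; rewrite xE /= d0 addr0 -expr2.
  move/eqP; rewrite sqrf_eq1 => /orP[/eqP a1|/eqP a1]; first by rewrite xE a1.
  have n2E : n.-1 = n.-2.+1 by rewrite prednK // -ltnS prednK // ltnW.
  (* A half turn would have [s = 0], so the sign is changed by two quarter turns. *)
  have -> : 1 :: nseq n.-1 0 = givens 0 1 0 (givens 0 1 0 x).
    by rewrite xE n2E /= a1 !mul0r !mul1r !subr0 !add0r; congr [:: _, _ & _]; ring.
  by rewrite !JG ?size_givens ?sdot_givens2 ?xn ?expr0n ?expr1n ?add0r ?oner_eq0.
have [v0|v0] := eqVneq x`_j.+1 0.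
  apply: IH => //; first exact: ltnW.
  by move=> i; rewrite leq_eqVlt => /predU1P[<-//|]; apply: x0.
set u := x`_j; set v := x`_j.+1 in v0.
have r2 : 0 < u ^+ 2 + v ^+ 2.
  by rewrite ltr_wpDl ?sqr_ge0 // lt_def sqr_ge0 expf_neq0.
(* Cosine [u / r] and sine [- v / r] send the pair of coordinates [u], [v] to [r], [0]. *)
pose r := Num.sqrt (u ^+ 2 + v ^+ 2).
have r0 : r != 0 by rewrite gt_eqF // sqrtr_gt0.
have rr : r ^+ 2 = u ^+ 2 + v ^+ 2 by rewrite sqr_sqrtr // ltW.
have cs : (u / r) ^+ 2 + (- v / r) ^+ 2 = 1.
  by rewrite !expr_div_n sqrrN -mulrDl -rr divff // expf_neq0.
rewrite -(@JG (u / r) (- v / r) j x) //; last by rewrite mulf_neq0 ?oppr_eq0 ?invr_neq0.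
apply: IH; rewrite ?size_givens ?sdot_givens2 ?xn //; first exact: ltnW.
move=> i; rewrite leq_eqVlt => /predU1P[<-|ji].
  by rewrite nth_givensS ?xn // -/u -/v; field.
by rewrite nth_givens_gt // x0.
Qed.
End invariant.

(** The integrand of [sphere_int] for a power of the linear form of [x], in list coordinates. *)
Definition cone_power k x s : R :=
  (if Num.sqrt (sdot s s) <= 1 then 1 else 0) * ((Num.sqrt (sdot s s))^-1 * sdot x s) ^+ k.

Lemma measurable_sdot n (d : measure_display) (T : measurableType d) (us vs : seq (T -> R)) :
  size us = n -> size vs = n ->
  (forall i, measurable_fun setT (nth (cst 0) us i)) ->
  (forall i, measurable_fun setT (nth (cst 0) vs i)) ->
  measurable_fun setT (fun z => sdot [seq u z | u <- us] [seq u z | u <- vs]).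
Proof.
elim: n us vs => [|n IH] [|u us] [|v vs] //= [un] [vn] mus mvs.
apply: measurable_funD; first exact: (measurable_funM (mus 0%N) (mvs 0%N)).
by apply: IH => // i; [apply: (mus i.+1)|apply: (mvs i.+1)].
Qed.

Lemma sdot_ge0 x : 0 <= sdot x x.
Proof. by elim: x => [|a x IH] //=; rewrite addr_ge0 // -expr2 sqr_ge0. Qed.

Lemma sqrtV_powR (a : R) : 0 <= a -> (Num.sqrt a)^-1 = a `^ (- 2^-1).
Proof. by move=> a0; rewrite powRN powR12_sqrt. Qed.

(** The squared norm of [x - t y] is nonnegative. Below, [t] is the inverse norm or its opposite,
    which at the origin is 0. *)
Lemma sdot_le n x y (t : R) : size x = n -> size y = n ->
  2 * (t * sdot x y) <= sdot x x + t ^+ 2 * sdot y y.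
Proof.
elim: n x y => [|n IH] [|a x] [|b y] //=; first by rewrite !mulr0 addr0.
move=> [xn] [yn]; have := IH x y xn yn; rewrite -subr_ge0 => h; rewrite -subr_ge0.
have -> : a * a + sdot x x + t ^+ 2 * (b * b + sdot y y) - 2 * (t * (a * b + sdot x y)) =
  (a - t * b) ^+ 2 + (sdot x x + t ^+ 2 * sdot y y - 2 * (t * sdot x y)) by ring.
by rewrite addr_ge0 ?sqr_ge0.
Qed.

Lemma cone_power_le1 n k x s : size x = n -> size s = n -> sdot x x = 1 ->
  `|cone_power k x s| <= 1.
Proof.
move=> xn sn x1; rewrite /cone_power; case: ifP => _; last by rewrite mul0r normr0.
rewrite mul1r normrX exprn_ile1 //.
set t := (Num.sqrt (sdot s s))^-1.
have h : t ^+ 2 * sdot s s <= 1.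
  rewrite /t exprVn sqr_sqrtr ?sdot_ge0 //.
  by have [->|ne] := eqVneq (sdot s s) 0; rewrite ?mulr0 // mulVf.
move: (sdot_le t xn sn) (sdot_le (- t) xn sn) h.
rewrite sqrrN x1 mulNr; move: (t * _) (t ^+ 2 * _) => w q h1 h2 h.
by rewrite ler_norml; apply/andP; split; lra.
Qed.

Lemma seq_bounded_supported_cone_power n k x : size x = n -> sdot x x = 1 ->
  seq_bounded_supported n (cone_power k x).
Proof.
move=> xn x1; split.
- move=> d T us us_n mus; rewrite /cone_power.
  have mss := measurable_sdot us_n us_n mus mus.
  have mxs : measurable_fun setT (fun z => sdot x [seq u z | u <- us]).
    have -> : (fun z => sdot x [seq u z | u <- us]) =
      (fun z => sdot [seq u z | u <- [seq (cst a : T -> R) | a <- x]] [seq u z | u <- us]).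
      by apply/funext => z; rewrite -map_comp (@eq_map _ _ _ id) // map_id.
    apply: (measurable_sdot (n := n)) => //; first by rewrite size_map.
    move=> i; have [hi|hi] := ltnP i (size x); first by rewrite (nth_map 0).
    by rewrite nth_default ?size_map.
  have msq : measurable_fun setT (fun z => Num.sqrt (sdot [seq u z | u <- us] [seq u z | u <- us])).
    under eq_fun do rewrite -powR12_sqrt ?sdot_ge0 //.
    exact: (measurableT_comp (measurable_powR _) mss).
  apply: measurable_funM.
    apply: measurable_fun_ifT => //.
    exact: (measurable_fun_ler msq (measurable_cst _)).
  apply: measurable_funX; apply: measurable_funM => //.
  under eq_fun do rewrite sqrtV_powR ?sdot_ge0 //.
  exact: (measurableT_comp (measurable_powR _) mss).
- by exists 1 => s sn; apply: (@cone_power_le1 n).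
- exists 1 => s i sn i_n hi; rewrite /cone_power ifN ?mul0r //.
  rewrite -ltNge (lt_le_trans hi) // -sqrtr_sqr ler_wsqrtr //.
  rewrite (sdotE sn sn) (bigD1 (Ordinal i_n)) //= -expr2 lerDl sumr_ge0 // => j _.
  by rewrite -expr2 sqr_ge0.
Qed.

(** A rotation of [x] is moved, as its inverse, to the integration variable, where [iterint_givens]
    absorbs it. *)
Lemma iterint_cone_power_const n k x : (1 < n)%N -> size x = n -> sdot x x = 1 ->
  iterint n (cone_power k x) = iterint n (cone_power k (1 :: nseq n.-1 0)).
Proof.
move=> n2; apply: (@givens_invariant_const n (fun x => iterint n (cone_power k x)) n2).
move=> c s p {}x s0 cs pn xn x1.
have csN : c ^+ 2 + (- s) ^+ 2 = 1 by rewrite sqrrN.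
rewrite -[RHS](@iterint_givens _ c (- s) p) ?oppr_eq0 //; last exact: seq_bounded_supported_cone_power.
apply: eq_iterint => y yn.
by rewrite /cone_power /= sdot_givens2 ?yn // sdot_givens ?xn // opprK.
Qed.

Lemma sphere_int_power_const (d k : nat) (x y : 'rV[R]_d.+1) : (1 <= d)%N ->
  dotp x x = 1 -> dotp y y = 1 ->
  sphere_int (fun z => dotp x z ^+ k) = sphere_int (fun z => dotp y z ^+ k).
Proof.
move=> d1.
have dvE (u : 'rV[R]_d.+1) s : size s = d.+1 ->
    dotp u (vec_of_seq d.+1 s) = sdot [seq u 0 i | i <- enum 'I_d.+1] s.
  move=> sn; have un : size [seq u 0 i | i <- enum 'I_d.+1] = d.+1 by rewrite size_map size_enum_ord.
  rewrite (sdotE un sn) /dotp.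
  apply: eq_bigr => i _; rewrite mxE (nth_map ord0) ?size_enum_ord //.
  by rewrite nth_ord_enum.
have ssE : forall s, size s = d.+1 -> dotp (vec_of_seq d.+1 s) (vec_of_seq d.+1 s) = sdot s s.
  by move=> s sn; rewrite (sdotE sn sn) /dotp; apply: eq_bigr => i _; rewrite !mxE.
have uuE (u : 'rV[R]_d.+1) :
    dotp u u = sdot [seq u 0 i | i <- enum 'I_d.+1] [seq u 0 i | i <- enum 'I_d.+1].
  have un : size [seq u 0 i | i <- enum 'I_d.+1] = d.+1 by rewrite size_map size_enum_ord.
  rewrite (sdotE un un) /dotp.
  by apply: eq_bigr => i _; rewrite (nth_map ord0) ?size_enum_ord // nth_ord_enum.
suff H (u : 'rV[R]_d.+1) : dotp u u = 1 ->
    lebint (fun z => unit_ball_ind z * dotp u ((enorm z)^-1 *: z) ^+ k) =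
    iterint d.+1 (cone_power k (1 :: nseq d 0)).
  by move=> x1 y1; rewrite /sphere_int !H.
move=> u1; rewrite /lebint -(@iterint_cone_power_const d.+1 k [seq u 0 i | i <- enum 'I_d.+1]) //.
- apply: eq_iterint => s sn; rewrite /cone_power /unit_ball_ind /enorm ssE //.
  congr (_ * _ ^+ k); rewrite -dvE // /dotp mulr_sumr; apply: eq_bigr => i _.
  by rewrite !mxE mulrCA.
- by rewrite size_map size_enum_ord.
- by rewrite -uuE.
Qed.

End moments.

(** * Zonal functions and positive definite kernels *)

Section sphere_kernels.
Context {R : realType} {d : nat}.
Local Notation V := ('rV[R]_d.+1).
Implicit Types (x y z v : V) (p q P : {poly R}) (k n S : nat).

Lemma dotpC x y : dotp x y = dotp y x.
Proof. by apply: eq_bigr => i _; rewrite mulrC. Qed.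

Lemma dotpDl x y z : dotp (x + y) z = dotp x z + dotp y z.
Proof. by rewrite /dotp -big_split; apply: eq_bigr => i _; rewrite mxE mulrDl. Qed.

Lemma dotpZl c x z : dotp (c *: x) z = c * dotp x z.
Proof. by rewrite /dotp mulr_sumr; apply: eq_bigr => i _; rewrite mxE mulrA. Qed.

Lemma dotpNl x z : dotp (- x) z = - dotp x z.
Proof. by rewrite -scaleN1r dotpZl mulN1r. Qed.

Lemma dotpDr x y z : dotp z (x + y) = dotp z x + dotp z y.
Proof. by rewrite !(dotpC z) dotpDl. Qed.

Lemma dotpZr c x z : dotp z (c *: x) = c * dotp z x.
Proof. by rewrite !(dotpC z) dotpZl. Qed.

Lemma dotpNr x z : dotp z (- x) = - dotp z x.
Proof. by rewrite !(dotpC z) dotpNl. Qed.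

Lemma dotp_ge0 x : 0 <= dotp x x.
Proof. by apply: sumr_ge0 => i _; rewrite -expr2 sqr_ge0. Qed.

Lemma dotp_eq0 x : dotp x x = 0 -> x = 0.
Proof.
move/eqP; rewrite psumr_eq0 => [/allP h|i _]; last by rewrite -expr2 sqr_ge0.
apply/rowP => i; have := h i (mem_index_enum i); rewrite /= mxE mulf_eq0 orbb => /eqP.
by [].
Qed.

Lemma sqdistE x y : sphere d x -> sphere d y -> sqdist x y = 2 - 2 * dotp x y.
Proof.
rewrite /sphere /= /sqdist => hx hy.
by rewrite dotpDl !dotpDr !dotpNl !dotpNr hx hy (dotpC y x); ring.
Qed.

Lemma dotp_le1 x y : sphere d x -> sphere d y -> -1 <= dotp x y <= 1.
Proof.
rewrite /sphere /= => hx hy; have := dotp_ge0 (x - y); have := dotp_ge0 (x + y).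
rewrite !dotpDl !dotpDr !dotpNl !dotpNr hx hy (dotpC y x) => h1 h2.
by apply/andP; split; lra.
Qed.

Lemma dotp_eq1 x y : sphere d x -> sphere d y -> dotp x y = 1 -> x = y.
Proof.
move=> hx hy e; apply/eqP; rewrite -subr_eq0; apply/eqP/dotp_eq0.
by have := sqdistE hx hy; rewrite /sqdist e => ->; ring.
Qed.

Lemma sphereN x : sphere d x -> sphere d (- x).
Proof. by rewrite /sphere /= dotpNl dotpNr opprK. Qed.

Lemma dotp_eqN1 x y : sphere d x -> sphere d y -> dotp x y = -1 -> y = - x.
Proof.
move=> hx hy e; apply/esym/(dotp_eq1 (sphereN hx) hy).
by rewrite dotpNl e opprK.
Qed.

(** Words instead of multi-indices expand [dotp x y ^+ k] without multinomial coefficients. *)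
Fixpoint words k : seq (seq 'I_d.+1) :=
  if k is k'.+1 then [seq i :: u | i <- enum 'I_d.+1, u <- words k'] else [:: [::]].

Lemma mem_words k u : (u \in words k) = (size u == k).
Proof.
elim: k u => [|k IH] u /=; first by rewrite inE size_eq0.
apply/allpairsP/idP => [[[i u'] /= [_ + ->]]|]; first by rewrite IH.
by case: u => // i u; rewrite /= eqSS -IH => hu; exists (i, u); rewrite mem_enum.
Qed.

Definition monomial (u : seq 'I_d.+1) x : R := \prod_(i <- u) x 0 i.

Lemma dotp_exp_words k x y : dotp x y ^+ k = \sum_(u <- words k) monomial u x * monomial u y.
Proof.
elim: k => [|k IH]; first by rewrite big_seq1 /monomial !big_nil mulr1 expr0.
rewrite big_allpairs_dep exprS IH /dotp mulr_suml big_enum /=; apply: eq_bigr => i _.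
by rewrite mulr_sumr; apply: eq_bigr => u _; rewrite /monomial !big_cons mulrACA.
Qed.

Lemma monomial_exponents u x : monomial u x = \prod_i x 0 i ^+ [ffun i => count_mem i u] i.
Proof.
elim: u => [|j u IH]; rewrite /monomial.
  by rewrite big_nil big1 // => i _; rewrite ffunE expr0.
rewrite big_cons -/(monomial u x) IH (bigD1 j) //= [RHS](bigD1 j) //= !ffunE /= eqxx add1n exprS mulrA.
by congr (_ * _); apply: eq_bigr => i ij; rewrite !ffunE /= eq_sym (negPf ij).
Qed.

Lemma sum_exponents u : (\sum_(i < d.+1) [ffun i => count_mem i u] i)%N = size u.
Proof.
elim: u => [|j u IH]; first by rewrite big1 // => i _; rewrite ffunE.
rewrite -[size (j :: u)]/(size u).+1 -IH (bigD1 j) //= [in RHS](bigD1 j) //= !ffunE /= eqxx add1n addSn.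
by congr (_ + _).+1; apply: eq_bigr => i ij; rewrite !ffunE /= eq_sym (negPf ij).
Qed.

Lemma polyfun_le_dotp_exp x k S : (k <= S)%N -> polyfun_le S (fun y => dotp x y ^+ k).
Proof.
move=> kS; exists [seq (monomial u x, [ffun i => count_mem i u]) | u <- words k]; split.
  apply/allP => c /mapP[u]; rewrite mem_words => /eqP uk -> /=.
  by rewrite sum_exponents uk.
move=> y; rewrite big_map dotp_exp_words; apply: eq_bigr => u _ /=.
by rewrite -monomial_exponents.
Qed.

Lemma poly_ext p q : (forall t : R, p.[t] = q.[t]) -> p = q.
Proof.
move=> pq; apply/eqP; rewrite -subr_eq0; apply/eqP.
apply: (roots_geq_poly_eq0 (rs := [seq i%:R | i <- iota 0 (size (p - q))])).
- by apply/allP => t _; rewrite rootE hornerD hornerN pq subrr.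
- by rewrite map_inj_uniq ?iota_uniq // => i j /eqP; rewrite eqr_nat => /eqP.
- by rewrite size_map size_iota.
Qed.

Section design.
Variables (N S : nat) (z : 'I_N -> V).
Hypotheses (d1 : (1 <= d)%N) (zd : spherical_design S z).

Lemma design_power_const k x y : (k <= S)%N -> sphere d x -> sphere d y ->
  \sum_i dotp x (z i) ^+ k = \sum_i dotp y (z i) ^+ k.
Proof.
move=> kS hx hy.
have := zd (polyfun_le_dotp_exp x kS); rewrite (sphere_int_power_const k d1 hx hy).
rewrite -(zd (polyfun_le_dotp_exp y kS)).
case: (posnP N) => [N0|N0]; last by apply: mulfI; rewrite invr_eq0 pnatr_eq0 -lt0n.
by move=> _; rewrite !big1 // => i; have := ltn_ord i; rewrite {2}N0.
Qed.

(** Homogeneity extends the constancy on the sphere to all [v]; for odd [k] the constant is 0, by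
    comparing a vector with its opposite. The exponent [k./2] keeps the right side polynomial in
    [v], so that coefficients can be compared later. *)
Lemma design_power k : (k <= S)%N ->
  exists c : R, forall v, \sum_i dotp v (z i) ^+ k = c * dotp v v ^+ k./2.
Proof.
move=> kS; pose e : V := delta_mx 0 0.
have he : sphere d e.
  rewrite /sphere /= /dotp (bigD1 0) //= big1 ?addr0 => [|i i0]; rewrite !mxE ?eqxx ?mulr1 //.
  by rewrite (negPf i0) mulr0.
pose c := \sum_i dotp e (z i) ^+ k.
have c_odd : odd k -> c = 0.
  move=> ko; have := design_power_const kS he (sphereN he); rewrite -/c.
  rewrite (eq_bigr (fun i => - (dotp e (z i) ^+ k))) => [|i _].
    by rewrite sumrN -/c; lra.
  by rewrite dotpNl exprNn -signr_odd ko expr1 mulN1r.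
exists c => v; have [v0|v0] := eqVneq (dotp v v) 0.
  have -> : v = 0 by exact: dotp_eq0.
  have e0 y : dotp 0 y = 0 by rewrite -(scale0r y) dotpZl mul0r.
  rewrite e0; case: k @c {kS} c_odd => [|[|k]] c c_odd.
  - by rewrite expr0 mulr1; apply: eq_bigr => i _.
  - by rewrite c_odd // mul0r big1 // => i _; rewrite e0 expr1.
  - by rewrite /= !exprS !mul0r mulr0 big1 // => i _; rewrite e0 exprS mul0r.
pose r := Num.sqrt (dotp v v).
have rr : r ^+ 2 = dotp v v by rewrite sqr_sqrtr // dotp_ge0.
have r0 : r != 0 by rewrite gt_eqF // sqrtr_gt0 lt_def v0 dotp_ge0.
have hu : sphere d (r^-1 *: v).
  by rewrite /sphere /= dotpZl dotpZr -rr; field.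
have -> : \sum_i dotp v (z i) ^+ k = r ^+ k * c.
  rewrite /c (design_power_const kS he hu) mulr_sumr; apply: eq_bigr => i _.
  by rewrite -exprMn dotpZl mulVKf.
case ko: (odd k); first by rewrite c_odd // mulr0 mul0r.
by rewrite mulrC -rr -exprM mul2n even_halfK ?ko.
Qed.

(** A generating function of Gegenbauer type. Only the degree bound in [u] matters; it follows from
    the recurrence obtained by splitting off one factor. *)
Lemma coef_trinomial K n : exists T : {poly R}, (size T <= n.+1)%N /\
  forall u : R, ((1 + (2 * u) *: 'X + 'X ^+ 2) ^+ K)`_n = T.[u].
Proof.
elim/ltn_ind: n => n IHn in K *; elim: K => [|K [T [sT hT]]].
  by exists (n == 0)%:R%:P; rewrite size_polyC; split=> [|u]; [case: (_ != _)|rewrite expr0 coef1 hornerC].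
have E (u : R) : ((1 + (2 * u) *: 'X + 'X ^+ 2) ^+ K.+1)`_n =
    ((1 + (2 * u) *: 'X + 'X ^+ 2) ^+ K)`_n +
    2 * u * (if n is n'.+1 then ((1 + (2 * u) *: 'X + 'X ^+ 2) ^+ K)`_n' else 0) +
    (if n is n'.+2 then ((1 + (2 * u) *: 'X + 'X ^+ 2) ^+ K)`_n' else 0).
  rewrite exprSr; move: (_ ^+ K) => W.
  have -> : W * (1 + (2 * u) *: 'X + 'X ^+ 2) = W + (2 * u)%:P * (W * 'X) + W * 'X ^+ 2.
    by rewrite -mul_polyC; ring.
  rewrite !coefD coefCM coefMX coefMXn.
  by case: n {IHn sT hT} => [|[|n]] //=; rewrite subSS subSS subn0.
case: n IHn sT hT E => [|n] IHn sT hT E.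
  by exists T; split=> // u; rewrite E hT mulr0 !addr0.
have [T1 [sT1 hT1]] := IHn n (ltnSn n) K.
have s1 : (size (T + 2 *: (T1 * 'X))%R <= n.+2)%N.
  rewrite (leq_trans (size_polyD _ _)) // geq_max sT /=.
  rewrite (leq_trans (size_scale_leq _ _)) // (leq_trans (size_polyMleq _ _)) //.
  by rewrite size_polyX addn2.
case: n IHn sT hT E T1 sT1 hT1 s1 => [|n] IHn sT hT E T1 sT1 hT1 s1.
  exists (T + 2 *: (T1 * 'X)); split=> // u.
  by rewrite E hT hT1 addr0 !hornerE /=; ring.
have [T2 [sT2 hT2]] := IHn n (ltnW (ltnSn n.+1)) K.
exists (T + 2 *: (T1 * 'X) + T2); split.
  by rewrite (leq_trans (size_polyD _ _)) // geq_max s1 (leq_trans sT2) // ltnW.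
by move=> u; rewrite E hT hT1 hT2 !hornerE /=; ring.
Qed.

Definition zonal n (F : V -> V -> R) := exists T : {poly R}, (size T <= n)%N /\
  forall x y, sphere d x -> sphere d y -> F x y = T.[dotp x y].

Lemma zonal_sum n (I : Type) (s : seq I) (F : I -> V -> V -> R) :
  (forall i, zonal n (F i)) -> zonal n (fun x y => \sum_(i <- s) F i x y).
Proof.
move=> hF; elim: s => [|i s [T [sT hT]]].
  by exists 0; rewrite size_poly0; split=> // x y _ _; rewrite big_nil horner0.
have [U [sU hU]] := hF i; exists (U + T); split.
  by rewrite (leq_trans (size_polyD _ _)) // geq_max sU.
by move=> x y hx hy; rewrite big_cons hU // hT // hornerD.
Qed.

Lemma zonalZ n (c : R) F : zonal n F -> zonal n (fun x y => c * F x y).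
Proof.
move=> [T [sT hT]]; exists (c *: T); split; first exact: leq_trans (size_scale_leq _ _) _.
by move=> x y hx hy; rewrite hT // hornerZ.
Qed.

Lemma zonal_widen n n' F : (n <= n')%N -> zonal n F -> zonal n' F.
Proof. by move=> nn [T [sT hT]]; exists T; split=> //; exact: leq_trans nn. Qed.

(* Compare the coefficients of [r ^ b] in
   [\sum_i ((x + r y) . z_i) ^ (a + b) = C |x + r y| ^ (a + b)]. *)
Lemma zonal_powers a b : (a + b <= S)%N ->
  zonal b.+1 (fun x y => \sum_i dotp x (z i) ^+ a * dotp y (z i) ^+ b).
Proof.
move=> abS; have [c hc] := design_power abS.
have [T [sT hT]] := coef_trinomial (a + b)./2 b.
(* In each summand the coefficient of the power [b] carries this binomial factor. *)
exists ((c / 'C(a + b, b)%:R) *: T); split; first exact: leq_trans (size_scale_leq _ _) _.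
move=> x y hx hy; pose u := dotp x y.
have E : \sum_i ((dotp x (z i))%:P + dotp y (z i) *: 'X) ^+ (a + b) =
    c *: (1 + (2 * u) *: 'X + 'X ^+ 2) ^+ (a + b)./2.
  apply: poly_ext => r; rewrite horner_sum hornerZ horner_exp.
  have -> : (1 + (2 * u) *: 'X + 'X ^+ 2).[r] = dotp (x + r *: y) (x + r *: y).
    rewrite !hornerE dotpDl !dotpDr !dotpZl !dotpZr hx hy (dotpC y x) -/u /=; ring.
  rewrite -hc; apply: eq_bigr => i _.
  by rewrite horner_exp !hornerE dotpDl dotpZl mulrC.
have := congr1 (fun p => p`_b) E; rewrite /= coefZ hT coef_sum => Eb.
rewrite hornerZ -/u mulrAC -Eb mulr_suml; apply: eq_bigr => i _.
rewrite exprDn coef_sum (bigD1 (inord b)) //= big1 ?addr0.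
  rewrite inordK ?ltnS ?leq_addl // addnK exprZn -rmorphXn /= coefMn coefCM coefZ coefXn eqxx mulr1.
  by rewrite -[X in X / _]mulr_natr mulfK // pnatr_eq0 -lt0n bin_gt0 leq_addl.
move=> j jb; rewrite exprZn -rmorphXn /= coefMn coefCM coefZ coefXn.
have -> : (b == j :> nat) = false.
  apply/negbTE; apply: contra jb => /eqP bj; apply/eqP/val_inj.
  by rewrite /= inordK ?ltnS ?leq_addl.
by rewrite mulr0 mulr0 mul0rn.
Qed.

(** The degree in [x . y] is bounded by that of [q] alone: convolving with [p] does not raise the
    degree of [q], which gives the orthogonality in [pd_kernel_orthogonal]. *)
Lemma zonal_product p q : (size p + size q <= S.+2)%N ->
  zonal (size q) (fun x y => \sum_i p.[dotp x (z i)] * q.[dotp y (z i)]).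
Proof.
move=> spq.
pose G (ab : 'I_(size p) * 'I_(size q)) x y :=
  (p`_ab.1 * q`_ab.2) * \sum_i dotp x (z i) ^+ ab.1 * dotp y (z i) ^+ ab.2.
have [T [sT hT]] : zonal (size q) (fun x y => \sum_ab G ab x y).
  apply: zonal_sum => -[a b]; apply: zonalZ; apply: (zonal_widen (ltn_ord b)).
  apply: zonal_powers => /=; move: (ltn_ord a) (ltn_ord b) => ha hb.
  by have := leq_add ha hb; rewrite addSn addnS => h; have := leq_trans h spq; rewrite !ltnS.
exists T; split=> // x y hx hy; rewrite -hT //.
under [RHS]eq_bigr => ab _ do rewrite /G mulr_sumr.
rewrite exchange_big /=; apply: eq_bigr => i _.
rewrite !horner_coef mulr_suml.
under [LHS]eq_bigr do rewrite mulr_sumr.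
by rewrite pair_big /=; apply: eq_bigr => -[a b] _ /=; ring.
Qed.

Lemma design_const p x y : (size p <= S.+1)%N -> sphere d x -> sphere d y ->
  \sum_i p.[dotp x (z i)] = \sum_i p.[dotp y (z i)].
Proof.
move=> sp hx hy; have E v : \sum_i p.[dotp v (z i)] = \sum_(k < size p) p`_k * \sum_i dotp v (z i) ^+ k.
  under eq_bigr do rewrite horner_coef.
  by rewrite exchange_big; apply: eq_bigr => k _; rewrite mulr_sumr.
rewrite !E; apply: eq_bigr => k _; congr (_ * _).
by apply: design_power_const => //; rewrite -ltnS (leq_trans (ltn_ord k)).
Qed.

End design.
End sphere_kernels.

(** * Positive definite kernels obtained from a design *)

Section pd_kernels.
Context {R : realType} {d : nat}.
Local Notation V := ('rV[R]_d.+1).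
Implicit Types (x y : V) (p q P : {poly R}) (k n S : nat).

(** Witnessed by a finite feature map, so that products of kernels are tensor products of maps and
    energies are sums of squares. *)
Definition pd_kernel p := exists (I : finType) (phi : I -> V -> R),
  forall x y, sphere d x -> sphere d y -> p.[dotp x y] = \sum_i phi i x * phi i y.

Lemma pd_kernel0 : pd_kernel 0.
Proof. by exists 'I_0, (fun _ _ => 0) => x y _ _; rewrite horner0 big_ord0. Qed.

Lemma pd_kernelD p q : pd_kernel p -> pd_kernel q -> pd_kernel (p + q).
Proof.
move=> [I [f hf]] [J [g hg]].
exists (I + J)%type, (fun ij => match ij with inl i => f i | inr j => g j end) => x y hx hy.
by rewrite hornerD hf // hg // big_sumType.
Qed.

Lemma pd_kernelZ (c : R) p : 0 <= c -> pd_kernel p -> pd_kernel (c *: p).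
Proof.
move=> c0 [I [f hf]]; exists I, (fun i x => Num.sqrt c * f i x) => x y hx hy.
rewrite hornerZ hf // mulr_sumr; apply: eq_bigr => i _.
by rewrite mulrACA -expr2 sqr_sqrtr.
Qed.

Lemma pd_kernelM p q : pd_kernel p -> pd_kernel q -> pd_kernel (p * q).
Proof.
move=> [I [f hf]] [J [g hg]].
exists (I * J)%type, (fun ij x => f ij.1 x * g ij.2 x) => x y hx hy.
rewrite hornerM hf // hg // mulr_suml.
under eq_bigr do rewrite mulr_sumr.
by rewrite pair_big /=; apply: eq_bigr => -[i j] _ /=; rewrite mulrACA.
Qed.

Definition pairsum N (w : 'I_N -> V) p := \sum_a \sum_b p.[dotp (w a) (w b)].

Lemma pairsumD N (w : 'I_N -> V) p q : pairsum w (p + q) = pairsum w p + pairsum w q.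
Proof.
rewrite /pairsum -big_split; apply: eq_bigr => a _.
by rewrite -big_split; apply: eq_bigr => b _; rewrite hornerD.
Qed.

Lemma pairsumZ N (w : 'I_N -> V) (c : R) p : pairsum w (c *: p) = c * pairsum w p.
Proof.
rewrite /pairsum mulr_sumr; apply: eq_bigr => a _.
by rewrite mulr_sumr; apply: eq_bigr => b _; rewrite hornerZ.
Qed.

Lemma pairsum_sum N (w : 'I_N -> V) n (F : 'I_n -> {poly R}) :
  pairsum w (\sum_i F i) = \sum_i pairsum w (F i).
Proof.
apply: (big_morph _ (pairsumD w)).
by rewrite -(scale0r 0) pairsumZ mul0r.
Qed.

(** The expression is the sum over the features of the squared difference of their totals over [w]
    and over [z]. *)
Lemma pd_kernel_energy M N (w : 'I_M -> V) (z : 'I_N -> V) p : pd_kernel p ->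
  config_on_sphere w -> config_on_sphere z ->
  0 <= pairsum w p - (\sum_a \sum_i p.[dotp (w a) (z i)]) *+ 2 + pairsum z p.
Proof.
move=> [I [f hf]] hw hz.
have E K L (u : 'I_K -> V) (v : 'I_L -> V) : config_on_sphere u -> config_on_sphere v ->
    \sum_a \sum_b p.[dotp (u a) (v b)] = \sum_r (\sum_a f r (u a)) * (\sum_b f r (v b)).
  move=> hu hv; under eq_bigr do under eq_bigr do rewrite hf //.
  under eq_bigr do rewrite exchange_big /=.
  rewrite exchange_big /=; apply: eq_bigr => r _; rewrite mulr_suml.
  by apply: eq_bigr => a _; rewrite mulr_sumr.
rewrite /pairsum !E // -sumrMnl -sumrB -big_split /=; apply: sumr_ge0 => r _.
by rewrite -!expr2 -sqrrB sqr_ge0.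
Qed.

Section design_kernels.
Variables (N S : nat) (z : 'I_N -> V).
Hypotheses (d1 : (1 <= d)%N) (N0 : (0 < N)%N).
Hypotheses (zS : config_on_sphere z) (zd : spherical_design S z).

(** The weights of the discrete measure to which the theory of orthogonal polynomials is applied. *)
Definition multiplicity (t : R) : R := \sum_a \sum_b (dotp (z a) (z b) == t)%:R.

Lemma pairsumE (u : seq R) p : uniq u -> (forall a b, dotp (z a) (z b) \in u) ->
  pairsum z p = wsum multiplicity u p.
Proof.
move=> uu hu; rewrite /wsum /multiplicity.
under [RHS]eq_bigr do rewrite mulr_suml.
rewrite exchange_big; apply: eq_bigr => a _ /=.
under [RHS]eq_bigr do rewrite mulr_suml.
rewrite exchange_big; apply: eq_bigr => b _ /=.
rewrite (bigD1_seq (dotp (z a) (z b))) //= eqxx mul1r big1 ?addr0 // => t /negPf tn.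
by rewrite eq_sym tn mul0r.
Qed.

Lemma multiplicity_gt0 a b : 0 < multiplicity (dotp (z a) (z b)).
Proof.
have ge0 c e t : 0 <= (dotp (z c) (z e) == t)%:R :> R by case: (_ == _).
rewrite /multiplicity (bigD1 a) //= (bigD1 b) //= eqxx -addrA ltr_pwDl ?ltr01 //.
by rewrite addr_ge0 // sumr_ge0 // => c _; rewrite ?sumr_ge0.
Qed.

(* Funk-Hecke: [\sum_i P (x . z_i) P (y . z_i)] is a polynomial in [x . y] of
   degree at most [k], orthogonal to lower degrees, hence a multiple of [P]. *)
Lemma pd_kernel_orthogonal (s : seq R) k P : pairwise <%R (rcons s 1) ->
  (forall a b, dotp (z a) (z b) \in rcons s 1) ->
  (forall t, t \in rcons s 1 -> 0 < multiplicity t) ->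
  (k <= size s)%N -> (k.*2 <= S)%N ->
  monic_orthogonal (wsum multiplicity (rcons s 1)) k P -> pd_kernel P.
Proof.
move=> pw hu l0 ks kS oP; have [mP sP oP'] := oP.
have us : uniq (rcons s 1) by apply: pairwise_uniq pw; exact: ltxx.
have LE p := pairsumE p us hu.
have [|T [sT hT]] := zonal_product d1 zd (p := P) (q := P).
  by rewrite sP addSn addnS addnn !ltnS.
rewrite sP in sT.
(* Summing over [b] first turns the pairing of [T] with [r] into that of [P] with a polynomial [U]
   of size at most [k], which is 0. *)
have Tr (r : {poly R}) : (size r <= k)%N -> pairsum z (T * r) = 0.
  move=> sr; have [|U [sU hU]] := zonal_product d1 zd (p := P) (q := r).
    rewrite sP addSn (leq_trans (n := (k + k).+1)) ?ltnS ?leq_add2l //.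
    by rewrite addnn ltnW.
  rewrite -(oP' U (leq_trans sU sr)) -LE; apply: eq_bigr => a _.
  transitivity (\sum_i P.[dotp (z a) (z i)] * \sum_b P.[dotp (z i) (z b)] * r.[dotp (z a) (z b)]).
    under [RHS]eq_bigr do rewrite mulr_sumr.
    rewrite exchange_big /=; apply: eq_bigr => b _.
    rewrite hornerM -hT // mulr_suml; apply: eq_bigr => i _.
    by rewrite (dotpC (z i)) mulrA.
  by apply: eq_bigr => i _; rewrite hU // hornerM (dotpC (z i)).
have TE : T = T`_k *: P.
  apply/eqP; rewrite -subr_eq0; apply/eqP; set Q := T - _.
  have sQ : (size Q <= k)%N.
    apply/leq_sizeP => j; rewrite coefB coefZ leq_eqVlt => /predU1P[<-|kj].
      by move: mP; rewrite monicE /lead_coef sP /= => /eqP ->; rewrite mulr1 subrr.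
    by rewrite (@nth_default _ 0 T j) ?(leq_trans sT) // (@nth_default _ 0 P j) ?sP // mulr0 subrr.
  apply: (wsum_sqr_eq0 us l0); first by rewrite size_rcons (leq_trans sQ) // leqW.
  rewrite -LE {1}/Q mulrBl -scalerAl -scaleN1r pairsumD pairsumZ pairsumZ Tr // add0r.
  by rewrite LE oP' // !mulr0.
(* On the diagonal the convolution is a sum of squares; as [P.[1]] is positive too, so is the factor
   relating [T] to [P]. *)
have T1 : 0 < T.[1].
  have NT : N%:R * T.[1] = pairsum z (P * P).
    transitivity (\sum_(a < N) T.[1]); first by rewrite sumr_const card_ord mulr_natl.
    apply: eq_bigr => a _; have za : dotp (z a) (z a) = 1 by exact: zS.
    by rewrite -za -hT //; apply: eq_bigr => i _; rewrite hornerM.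
  rewrite -(pmulr_rgt0 (x := N%:R)) ?ltr0n // NT LE wsum_sqr_gt0 ?monic_neq0 //.
  by rewrite sP size_rcons ltnS.
have P1 := monic_orthogonal_last_gt0 pw l0 ks oP.
have c0 : 0 < T`_k by rewrite -(pmulr_lgt0 _ P1) -hornerZ -TE.
have -> : P = (T`_k)^-1 *: (T`_k *: P) by rewrite scalerA mulVf ?scale1r // gt_eqF.
rewrite -TE; apply: pd_kernelZ; first by rewrite invr_ge0 ltW.
exists 'I_N, (fun i x => P.[dotp x (z i)]) => x y hx hy.
by rewrite -hT.
Qed.

End design_kernels.
End pd_kernels.

(** * Comparison of energies *)

Section optimality.
Context {R : realType} {d : nat}.
Local Notation V := ('rV[R]_d.+1).
Implicit Types (x y : V) (p q P : {poly R}).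

Section extremal.
Variables (N : nat) (z : 'I_N -> V) (e : bool) (ts : seq R).
Let ns := if e then -1 :: ts else ts.
Let S := (size ns + size ts)%N.
Hypotheses (d1 : (1 <= d)%N) (N0 : (0 < N)%N).
Hypotheses (zS : config_on_sphere z) (zd : spherical_design S z).
Hypotheses (uts : uniq ts) (tsI : forall t, t \in ts -> -1 < t < 1) (S0 : (0 < S)%N).
Hypothesis zdots : forall a b, a != b -> dotp (z a) (z b) \in ns.
Hypothesis pdt : forall j, (j <= size ts)%N -> pd_kernel (d := d) (prodXs (take j ts)).

Lemma nodes_size_le : (S <= (size ts).*2.+1)%N.
Proof. by rewrite /S /ns -addnn; case: (e) => //=; rewrite addSn. Qed.

Lemma node_lt1 t : t \in ns -> -1 <= t < 1.
Proof.
rewrite /ns; case: (e); last by move=> /tsI /andP[/ltW -> ->].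
rewrite inE => /predU1P[->|/tsI/andP[/ltW -> ->//]].
by rewrite lexx (lt_trans (ltrN10 R)) // ltr01.
Qed.

(** As -1 is the last node, none of these polynomials contains the factor ['X + 1]; each is a
    product of two partial products over [ts]. *)
Lemma newton_basis_pd j : (j < S)%N -> pd_kernel (d := d) (newton_basis ts j).
Proof.
move=> jS; have jt : (j <= (size ts).*2)%N by rewrite -ltnS (leq_trans jS) // nodes_size_le.
apply: pd_kernelM; apply: pdt; first by rewrite leq_uphalf_double.
by rewrite -[size ts]doubleK half_leq.
Qed.

Lemma newton_basis_lt j : (j < S)%N ->
  newton_basis ts j \is monic /\ size (newton_basis ts j) = j.+1.
Proof. by move=> jS; apply: newton_basisP; rewrite -ltnS (leq_trans jS) // nodes_size_le. Qed.

Section gap.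
Variable w : 'I_N -> V.
Hypothesis wS : config_on_sphere w.

Definition gap p := pairsum w p - pairsum z p.

Lemma gapZ c p : gap (c *: p) = c * gap p.
Proof. by rewrite /gap !pairsumZ; ring. Qed.

Lemma gap_sum n (F : 'I_n -> {poly R}) : gap (\sum_i F i) = \sum_i gap (F i).
Proof. by rewrite /gap !pairsum_sum -sumrB. Qed.

(** The potential of the design for [p] is the same at the points of [w] as at its own. *)
Lemma cross_pairsum p : (size p <= S.+1)%N ->
  \sum_a \sum_i p.[dotp (w a) (z i)] = pairsum z p.
Proof. by move=> sp; apply: eq_bigr => a _; apply: (design_const d1 zd). Qed.

Lemma gapE p : (size p <= S.+1)%N -> gap p =
  pairsum w p - (\sum_a \sum_i p.[dotp (w a) (z i)]) *+ 2 + pairsum z p.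
Proof. by move=> sp; rewrite cross_pairsum // /gap; ring. Qed.

Lemma gap_ge0 p : (size p <= S.+1)%N -> pd_kernel (d := d) p -> 0 <= gap p.
Proof. by move=> sp pp; rewrite gapE //; apply: pd_kernel_energy. Qed.

Lemma gap_const (c : R) : gap c%:P = 0.
Proof.
rewrite /gap /pairsum.
under eq_bigr do under eq_bigr do rewrite hornerC.
under [X in _ - X]eq_bigr do under eq_bigr do rewrite hornerC.
by rewrite subrr.
Qed.

End gap.

Section potential.
Variable hs : nat -> R -> R.
Hypothesis hD : derivatives_on (-1) 1 hs.
Hypothesis h0 : forall k (x : R), (0 < k)%N -> -1 < x < 1 -> 0 <= hs k x.
Let h := hs 0%N.

Lemma lower_interpolant : exists c : nat -> R,
  let H := \sum_(j < S) c j *: newton_basis ts j in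
  [/\ nodes_in (-1) 1 ns ts, interpolates hs H ns ts &
   forall j, (0 < j < S)%N -> exists2 y, -1 < y < 1 & hs j y = j`!%:R * c j].
Proof.
have [c [nd iH cP]] := hermite_newton hD uts tsI.
have [eE|eE] := boolP e; last first.
  exists c; rewrite /S /ns (negPf eE) addnn; split=> //.
set H := \sum_(j < _) _ in iH.
have N1 : -1 <= (-1 : R) <= 1 by rewrite lexx (le_trans (lerN10 R)) ?ler01.
have Nts : -1 \notin ts by apply/negP => /tsI; rewrite ltxx.
have [nd1 iH1] := interpolates_add_value iH nd N1 Nts.
set c1 := (_ / _) in iH1.
have sH : (size H <= (size ts).*2)%N by exact: size_newton_sum.
have [H1l sH1] := lead_addZ c1 sH (monic_prodXs2 ts ts) (etrans (size_prodXs2 ts ts) (congr1 succn (addnn _))).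
have SE : S = (size ts).*2.+1 by rewrite /S /ns eE /= addSn addnn.
exists (fun j => if (j < (size ts).*2)%N then c j else c1); rewrite /ns eE; split=> //.
  rewrite SE big_ord_recr /= ltnn.
  have -> : newton_basis ts (size ts).*2 = prodXs ts * prodXs ts.
    by rewrite /newton_basis uphalf_double doubleK take_size.
  have <- // : H = \sum_(i < (size ts).*2) (if (i < (size ts).*2)%N then c i else c1) *: newton_basis ts i.
  by apply: eq_bigr => i _; rewrite ltn_ord.
move=> j /andP[j0]; rewrite SE ltnS leq_eqVlt => /predU1P[jE|js]; last by rewrite js; apply: cP; rewrite j0.
rewrite jE ltnn -H1l; move: j0 H1l sH1; rewrite jE.
have := addnn (size ts); case: (_.*2) => // k kE _ H1l sH1.
by apply: (interpolates_lead hD nd1 iH1) => //; rewrite /= addSn kE.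
Qed.

Lemma node_poly_ge0 t : -1 <= t -> 0 <= (prodXs ns * prodXs ts).[t].
Proof.
move=> t1; have -> : prodXs ns = (if e then 'X - (-1)%:P else 1) * prodXs ts.
  by rewrite /ns /prodXs; case: (e); rewrite ?big_cons ?mul1r.
rewrite -mulrA hornerM hornerM -expr2 mulr_ge0 ?sqr_ge0 //.
by case: (e); rewrite ?hornerC // hornerXsubC subr_ge0.
Qed.

Lemma node_poly_neq0 t : t \notin ns -> (prodXs ns * prodXs ts).[t] != 0.
Proof.
move=> tn; rewrite hornerM mulf_neq0 // -rootE root_prodXs //.
by apply: contra tn; rewrite /ns; case: (e) => // h1; rewrite inE h1 orbT.
Qed.

Section lower.
Variable c : nat -> R.
Let H := \sum_(j < S) c j *: newton_basis ts j.
Hypotheses (nd : nodes_in (-1) 1 ns ts) (iH : interpolates hs H ns ts).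
Hypothesis cP : forall j, (0 < j < S)%N -> exists2 y, -1 < y < 1 & hs j y = j`!%:R * c j.

Lemma size_lower : (size H <= S)%N.
Proof.
apply: (leq_trans (size_sum _ _ _)); apply/bigmax_leqP => j _.
by rewrite (leq_trans (size_scale_leq _ _)) // (newton_basis_lt _).2.
Qed.

Lemma lower_error t : -1 <= t <= 1 -> t \notin ns ->
  exists2 y, -1 < y < 1 & h t - H.[t] = hs S y / S`!%:R * (prodXs ns * prodXs ts).[t].
Proof.
move=> t1 tn; have := size_lower; have := interpolation_error hD nd iH.
rewrite -/S; case: (S) S0 => // k _ hk sH.
exact: hk.
Qed.

Lemma lower_le t : -1 <= t <= 1 -> 0 <= h t - H.[t].
Proof.
move=> t1; have [tn|tn] := boolP (t \in ns); first by rewrite iH.1 // subrr.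
have [y y1 ->] := lower_error t1 tn.
rewrite mulr_ge0 ?node_poly_ge0 ?divr_ge0 ?ler0n ?h0 //.
by case/andP: t1.
Qed.

Lemma coef_lower_ge0 j : (0 < j < S)%N -> 0 <= c j.
Proof.
move=> jS; have [y y1 hy] := cP jS; have /andP[j0 _] := jS.
by rewrite -(pmulr_rge0 _ (x := j`!%:R)) ?ltr0n ?fact_gt0 // -hy h0.
Qed.

Lemma gap_lower w : gap w H = \sum_(j < S) c j * gap w (newton_basis ts j).
Proof. by rewrite gap_sum; apply: eq_bigr => j _; rewrite gapZ. Qed.

Lemma gap_lower_term_ge0 w (j : 'I_S) : config_on_sphere w ->
  0 <= c j * gap w (newton_basis ts j).
Proof.
move=> wS; case: (posnP j) => [->|j0].
  rewrite /newton_basis take0 /prodXs big_nil mul1r -polyC1 gap_const mulr0 //.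
rewrite mulr_ge0 //; first by rewrite coef_lower_ge0 // j0 ltn_ord.
apply: gap_ge0 => //; last exact: newton_basis_pd.
by rewrite (newton_basis_lt (ltn_ord j)).2 ltnS ltnW.
Qed.

(** The diagonal contributes [h 1 - H.[1]] per point for both configurations and cancels, so [H]
    need not interpolate at 1; off the diagonal [h] and [H] agree on the dot products of [z]. *)
Lemma energy_gapE w : config_on_sphere w ->
  \sum_a \sum_b h (dotp (w a) (w b)) - \sum_a \sum_b h (dotp (z a) (z b)) =
  \sum_a \sum_(b | b != a) (h (dotp (w a) (w b)) - H.[dotp (w a) (w b)]) + gap w H.
Proof.
move=> wS.
have E (u : 'I_N -> V) : config_on_sphere u -> \sum_a \sum_b h (dotp (u a) (u b)) =
    \sum_a \sum_(b | b != a) (h (dotp (u a) (u b)) - H.[dotp (u a) (u b)])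
    + \sum_(a < N) (h 1 - H.[1]) + pairsum u H.
  move=> uS; rewrite /pairsum -big_split -big_split /=; apply: eq_bigr => a _.
  rewrite (bigD1 a) //= [in X in _ = _ + X](bigD1 a) //=.
  have -> : dotp (u a) (u a) = 1 by exact: uS.
  by rewrite sumrB; ring.
rewrite !E // /gap.
rewrite [X in _ - (X + _ + _)]big1 => [|a _]; first by ring.
rewrite big1 // => b ba; rewrite iH.1 ?subrr //.
by apply: zdots; rewrite eq_sym.
Qed.

End lower.

Lemma energy_le (w : 'I_N -> V) : config_on_sphere w ->
  \sum_a \sum_b h (dotp (z a) (z b)) <= \sum_a \sum_b h (dotp (w a) (w b)).
Proof.
move=> wS; have [c [nd iH cP]] := lower_interpolant.
rewrite -subr_ge0 (energy_gapE iH wS) addr_ge0 //.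
  by apply: sumr_ge0 => a _; apply: sumr_ge0 => b _; apply: lower_le => //; apply: dotp_le1.
by rewrite gap_lower; apply: sumr_ge0 => j _; apply: gap_lower_term_ge0.
Qed.

Lemma potential_le x : sphere d x ->
  N%:R * \sum_i h (dotp x (z i)) <= \sum_a \sum_b h (dotp (z a) (z b)).
Proof.
move=> xS; have [c [nd iH _]] := lower_interpolant.
set H := \sum_(j < S) _ in iH.
have one1 : -1 <= (1 : R) <= 1 by rewrite lexx (le_trans (lerN10 R)) ?ler01.
have n1 : 1 \notin ns by apply/negP => /node_lt1; rewrite ltxx andbF.
have [nd1 iQ] := interpolates_add_value iH nd one1 n1.
set Q := H + _ in iQ.
have sQ : (size Q <= S.+1)%N.
  exact: (lead_addZ _ (size_lower c) (monic_prodXs2 ns ts) (size_prodXs2 ns ts)).2.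
have Qge t : -1 <= t <= 1 -> h t <= Q.[t].
  move=> t1; have [tn|tn] := boolP (t \in 1 :: ns); first by rewrite iQ.1.
  have [|y y1] := interpolation_error hD nd1 iQ _ sQ t1 tn; first by rewrite /= addSn.
  (* The simple node 1 contributes the factor [t - 1], which makes the error nonpositive. *)
  rewrite -subr_le0 => ->; rewrite mulr_ge0_le0 ?divr_ge0 ?ler0n ?h0 //.
  have /andP[t1l t1r] := t1.
  have -> : prodXs (1 :: ns) * prodXs ts = ('X - 1%:P) * (prodXs ns * prodXs ts).
    by rewrite /prodXs big_cons mulrA.
  by rewrite hornerM hornerXsubC mulr_le0_ge0 ?subr_le0 ?node_poly_ge0.
have Qz a b : h (dotp (z a) (z b)) = Q.[dotp (z a) (z b)].
  rewrite iQ.1 //; have [->|ab] := eqVneq a b; last by rewrite inE zdots ?orbT.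
  by have -> : dotp (z b) (z b) = 1; [exact: zS|rewrite mem_head].
have -> : \sum_a \sum_b h (dotp (z a) (z b)) = N%:R * \sum_i Q.[dotp x (z i)].
  transitivity (\sum_(a < N) \sum_i Q.[dotp x (z i)]); last by rewrite sumr_const card_ord mulr_natl.
  apply: eq_bigr => a _; rewrite (design_const d1 zd sQ xS (zS a)).
  by apply: eq_bigr => b _; rewrite Qz.
by rewrite ler_wpM2l ?ler0n //; apply: ler_sum => i _; apply: Qge; apply: dotp_le1.
Qed.

Section equality.
Hypothesis hpos : forall k (x : R), (0 < k)%N -> -1 < x < 1 -> 0 < hs k x.
Variable w : 'I_N -> V.
Hypothesis wS : config_on_sphere w.
Hypothesis wE : \sum_a \sum_b h (dotp (w a) (w b)) <= \sum_a \sum_b h (dotp (z a) (z b)).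

(** Both parts of [energy_gapE] are nonnegative with sum at most 0. Strict signs make the Newton
    coefficients of positive index nonzero, and the error nonzero off the nodes. *)
Lemma energy_equality : (forall j, (j < S)%N -> gap w (newton_basis ts j) = 0) /\
  (forall a b, a != b -> dotp (w a) (w b) \in ns).
Proof.
have [c [nd iH cP]] := lower_interpolant.
set H := \sum_(j < S) _ in iH.
have A0 a b : 0 <= h (dotp (w a) (w b)) - H.[dotp (w a) (w b)].
  by apply: lower_le => //; apply: dotp_le1.
have G0 (j : 'I_S) := gap_lower_term_ge0 cP j wS.
pose X := \sum_a \sum_(b | b != a) (h (dotp (w a) (w b)) - H.[dotp (w a) (w b)]).
pose Y := \sum_(j < S) c j * gap w (newton_basis ts j).
have XYE : \sum_a \sum_b h (dotp (w a) (w b)) - \sum_a \sum_b h (dotp (z a) (z b)) = X + Y.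
  by rewrite (energy_gapE iH wS) gap_lower.
have X0 : 0 <= X by apply: sumr_ge0 => a _; apply: sumr_ge0 => b _; apply: A0.
have Y0 : 0 <= Y by apply: sumr_ge0 => j _; apply: G0.
have XY : X + Y <= 0 by rewrite -XYE subr_le0.
have XE : X = 0 by apply/eqP; rewrite eq_le X0 andbT; lra.
have YE : Y = 0 by apply/eqP; rewrite eq_le Y0 andbT; lra.
split.
  move=> j jS; case: (posnP j) => [->|j0].
    by rewrite /newton_basis take0 /prodXs big_nil mul1r -polyC1 gap_const.
  move/eqP: YE; rewrite psumr_eq0 // => /allP /(_ (Ordinal jS) (mem_index_enum _)) /=.
  rewrite mulf_eq0 => /orP[/eqP cj|/eqP//].
  have [y y1] := cP j (introT andP (conj j0 jS)).
  by rewrite cj mulr0 => hy; have := hpos j0 y1; rewrite hy ltxx.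
move=> a b ab; apply/negPn/negP => tn.
have := lower_error nd iH (dotp_le1 (wS a) (wS b)) tn.
case=> y y1 hy.
have : h (dotp (w a) (w b)) - H.[dotp (w a) (w b)] = 0.
  move/eqP: XE; rewrite psumr_eq0 => [/allP /(_ a (mem_index_enum _))|a' _]; last exact: sumr_ge0.
  rewrite /= psumr_eq0 // => /allP /(_ b (mem_index_enum _)).
  by rewrite eq_sym ab /= => /eqP.
rewrite hy => /eqP; rewrite !mulf_eq0 (negPf (node_poly_neq0 tn)) orbF invr_eq0.
by rewrite (gt_eqF (hpos S0 y1)) pnatr_eq0 -leqn0 leqNgt fact_gt0.
Qed.

Lemma gap_eq0 p : (size p <= S)%N -> gap w p = 0.
Proof.
move=> sp; have [c ->] := monic_basis (fun j jS => newton_basis_lt jS) sp.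
by rewrite gap_sum big1 // => j _; rewrite gapZ energy_equality.1 // mulr0.
Qed.

(** For ['X^k] the gap is the sum, over words of length [k], of the squared differences of the two
    monomial sums. *)
Lemma monomial_sum_eq u : (size u < S)%N ->
  \sum_a monomial u (w a) = \sum_a monomial u (z a).
Proof.
move=> uS; set k := size u in uS.
have sX : (size ('X^k : {poly R}) <= S)%N by rewrite size_polyXn.
have := gap_eq0 sX; rewrite gapE //; last exact: leqW.
have E (v v' : 'I_N -> V) : \sum_a \sum_b ('X^k).[dotp (v a) (v' b)] =
    \sum_(u <- words k) (\sum_a monomial u (v a)) * (\sum_b monomial u (v' b)).
  under eq_bigr do under eq_bigr do rewrite hornerXn dotp_exp_words.
  under eq_bigr do rewrite exchange_big /=.
  rewrite exchange_big /=; apply: eq_bigr => u' _; rewrite mulr_suml.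
  by apply: eq_bigr => a _; rewrite mulr_sumr.
rewrite /pairsum !E -sumrMnl -sumrB -big_split /=.
under eq_bigr do rewrite -!expr2 -sqrrB.
move/eqP; rewrite psumr_eq0 => [/allP /(_ u)|? _]; last exact: sqr_ge0.
by rewrite mem_words eqxx => /(_ isT) /=; rewrite sqrf_eq0 subr_eq0 => /eqP.
Qed.

Lemma potential_sum_eq x p : (size p <= S)%N ->
  \sum_a p.[dotp x (w a)] = \sum_a p.[dotp x (z a)].
Proof.
move=> sp; have E (v : 'I_N -> V) : \sum_a p.[dotp x (v a)] =
   \sum_(k < size p) p`_k * \sum_(u <- words k) monomial u x * \sum_a monomial u (v a).
  under eq_bigr do rewrite horner_coef.
  rewrite exchange_big; apply: eq_bigr => k _; rewrite -mulr_sumr; congr (_ * _).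
  under eq_bigr do rewrite dotp_exp_words.
  by rewrite exchange_big; apply: eq_bigr => u _; rewrite -mulr_sumr.
rewrite !E; apply: eq_bigr => k _; congr (_ * _).
rewrite !big_seq; apply: eq_bigr => u; rewrite mem_words => /eqP uk.
by rewrite monomial_sum_eq // uk (leq_trans (ltn_ord k)).
Qed.

End equality.
End potential.
End extremal.
End optimality.

(** * The polarization problem *)

Section potentials.
Context {R : realType}.
Implicit Types (f g : R -> R).

Lemma within_continuous_precomp f g (A B : set R) : {within A, continuous f} ->
  continuous g -> (forall x, B x -> A (g x)) -> {within B, continuous (f \o g)}.
Proof.
move=> /subspace_continuousP fc gc gBA; apply/subspace_continuousP => x Bx.
apply: (@cvg_comp _ _ _ g f _ (within A (nbhs (g x)))); last exact/fc/gBA.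
move=> U /=; rewrite /within /= => hU; have := gc x _ hU.
rewrite !nbhs_simpl /=; apply: filterS => y Ay By; exact/Ay/gBA.
Qed.

(* The derivatives of [t |-> f (2 - 2 t)], with [f (|x - y|^2) = f (2 - 2 x.y)] on the sphere. *)
Definition dot_profile f c (k : nat) (t : R) : R :=
  if k is 0%N then f (2 - 2 * t)
  else (-2) ^+ k * derive1n k (fun s => f s + c) (2 - 2 * t).

Lemma dot_profile_derivatives f c : {within `[0, 4], continuous f} ->
  completely_monotone_oc (fun t => f t + c) 0 4 -> derivatives_on (-1) 1 (dot_profile f c).
Proof.
move=> fc [_ hd]; split.
  apply: (@within_continuous_precomp f (fun t => 2 - 2 * t) `[0, 4]%classic) => //.
    move=> x; apply: cvgB; first exact: cvg_cst.
    by apply: cvgM; [exact: cvg_cst|exact: cvg_id].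
  move=> x /=; rewrite !in_itv /= => /andP[x1 x2]; apply/andP; split; lra.
move=> k t /andP[t1 t2]; pose g s := f s + c.
have t04 : 0 < 2 - 2 * t < 4 by apply/andP; split; lra.
have dlin : is_derive t 1 (fun t : R => 2 - 2 * t) (- 2).
  have := is_deriveB (is_derive_cst (2 : R) t 1) (is_deriveM (is_derive_cst (2 : R) t 1) (is_derive_id t 1)).
  have -> : cst (2 : R) - cst 2 * id = (fun t : R => 2 - 2 * t) by [].
  by move/is_derive_eq; apply; rewrite scaler0 addr0 sub0r /GRing.scale /= mulr1.
have dg : is_derive t 1 (fun t => derive1n k g (2 - 2 * t)) (derive1n k.+1 g (2 - 2 * t) * - 2).
  apply: (@is_derive1_comp _ (derive1n k g) (fun t => 2 - 2 * t)) => //.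
  apply: DeriveDef; first exact: (hd k _ t04).1.
  by rewrite derive1nS derive1E.
case: k dg => [|k] dg.
  have := is_deriveB dg (is_derive_cst c t 1).
  rewrite /dot_profile expr1 subr0 mulrC.
  have -> : (fun t => derive1n 0 g (2 - 2 * t)) - cst c = (fun t => f (2 - 2 * t)).
    by apply/funext => s; rewrite /= /g !fctE /= addrK.
  by [].
rewrite /dot_profile.
have := is_deriveM (is_derive_cst ((-2) ^+ k.+1 : R) t 1) dg.
by move/is_derive_eq; apply; rewrite scaler0 addr0 /GRing.scale /= [in RHS]exprSr; ring.
Qed.

Lemma dot_profile_ge0 f c k t : completely_monotone_oc (fun t => f t + c) 0 4 ->
  (0 < k)%N -> -1 < t < 1 -> 0 <= dot_profile f c k t.
Proof.
move=> [_ hd]; case: k => // k _ /andP[t1 t2].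
have t04 : 0 < 2 - 2 * t < 4 by apply/andP; split; lra.
have [_] := hd k.+1 _ t04; rewrite /dot_profile => h.
by rewrite -[-2 in X in X ^+ _]mulN1r exprMn mulrAC mulrC mulr_ge0 // exprn_ge0.
Qed.

Lemma dot_profile_gt0 f c k t : strictly_completely_monotone_oc (fun t => f t + c) 0 4 ->
  (0 < k)%N -> -1 < t < 1 -> 0 < dot_profile f c k t.
Proof.
move=> [_ hd]; case: k => // k _ /andP[t1 t2].
have t04 : 0 < 2 - 2 * t < 4 by apply/andP; split; lra.
have := hd k.+1 _ t04; rewrite /dot_profile => h.
by rewrite -[-2 in X in X ^+ _]mulN1r exprMn mulrAC mulrC mulr_gt0 // exprn_gt0.
Qed.

Section polarization.
Variables (d N : nat) (f : R -> R).
Local Notation V := ('rV[R]_d.+1).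
Implicit Types (x : V) (w : 'I_N -> V).
Hypothesis fc : {within `[0, 4], continuous f}.
Let h t := f (2 - 2 * t).

Lemma potE w x : config_on_sphere w -> sphere d x -> pot f w x = \sum_i h (dotp x (w i)).
Proof. by move=> wS xS; apply: eq_bigr => i _; rewrite sqdistE. Qed.

Lemma pot_bounded w : config_on_sphere w -> has_ubound (pot f w @` sphere d).
Proof.
move=> wS; have [c _ fle] := EVT_max (ler0n R 4) fc.
exists (\sum_(i < N) f c) => _ [x xS <-]; apply: ler_sum => i _; apply: fle.
rewrite sqdistE // in_itv /=; have /andP[h1 h2] := dotp_le1 xS (wS i).
by apply/andP; split; lra.
Qed.

Lemma energy_le_Qf w : config_on_sphere w ->
  \sum_a \sum_b h (dotp (w a) (w b)) <= N%:R * Qf f w.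
Proof.
move=> wS; rewrite mulr_natl -[X in _ *+ X]card_ord -sumr_const; apply: ler_sum => a _.
rewrite -potE //; apply: ub_le_sup; first exact: pot_bounded.
by exists (w a).
Qed.

Lemma Qf_le w (M : R) (a : 'I_N) : config_on_sphere w ->
  (forall x, sphere d x -> N%:R * \sum_i h (dotp x (w i)) <= M) -> N%:R * Qf f w <= M.
Proof.
move=> wS hM; have N0 : (0 : R) < N%:R by rewrite ltr0n; exact: leq_ltn_trans (ltn_ord a).
rewrite mulrC -ler_pdivlMr //; apply: ge_sup; first by exists (pot f w (w a)), (w a).
by move=> _ [x xS <-]; rewrite ler_pdivlMr // mulrC potE // hM.
Qed.

End polarization.
End potentials.

(** * Antipodality, monomial sums and the design property *)

Section configurations.
Context {R : realType} {d N : nat}.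
Local Notation V := ('rV[R]_d.+1).
Implicit Types (w z : 'I_N -> V) (x : V) (ts s : seq R).

Lemma mem_dot_products w t :
  reflect (exists a b, a != b /\ dotp (w a) (w b) = t) (t \in dot_products w).
Proof.
rewrite /dot_products mem_undup; apply: (iffP mapP) => [[[a b]]|[a [b [ab <-]]]].
  by rewrite mem_filter /= => /andP[ab _] ->; exists a, b.
by exists (a, b) => //; rewrite mem_filter /= ab mem_enum inE.
Qed.

(** The test polynomial vanishes on [ts], so a point without antipode would see only its own
    term. *)
Lemma antipodal_from_count w ts : config_on_sphere w ->
  (forall a b, a != b -> dotp (w a) (w b) \in -1 :: ts) ->
  (forall a, (prodXs ts * prodXs ts).[1] < \sum_b (prodXs ts * prodXs ts).[dotp (w a) (w b)]) ->
  antipodal w.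
Proof.
move=> wS hts hlt a; apply: contrapT => na.
have := hlt a; rewrite (bigD1 a) //=.
have -> : dotp (w a) (w a) = 1 by exact: wS.
rewrite big1 ?addr0 ?ltxx // => b ba.
have := hts a b; rewrite eq_sym ba => /(_ isT); rewrite inE => /predU1P[e|].
  by case: na; exists b; apply: dotp_eqN1 e.
by move=> tn; rewrite horner_prodXs2_eq0.
Qed.

(** An antipode adds a positive term to the diagonal one. When the potential is constant,
    [antipodal_from_count] then propagates one antipodal pair to all points. *)
Lemma count_with_antipode w ts a b : config_on_sphere w -> dotp (w a) (w b) = -1 ->
  -1 \notin ts ->
  (prodXs ts * prodXs ts).[1] < \sum_i (prodXs ts * prodXs ts).[dotp (w a) (w i)].
Proof.
move=> wS ab Nts.
have ww c : dotp (w c) (w c) = 1 by exact: wS.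
have ne : b != a.
  apply/eqP => e; move: ab; rewrite e ww => /eqP; apply/negP.
  by rewrite gt_eqF // (lt_trans (ltrN10 R)) // ltr01.
have sq t : 0 <= (prodXs ts * prodXs ts).[t] by rewrite hornerM -expr2 sqr_ge0.
rewrite (bigD1 a) //= (bigD1 b) //= ab ww ltrDl ltr_pwDl ?sumr_ge0 //.
rewrite lt_def sq andbT hornerM mulf_eq0 orbb.
by move: Nts; rewrite -root_prodXs.
Qed.

Lemma polyfun_le_widen k n (p : V -> R) : (k <= n)%N -> polyfun_le k p -> polyfun_le n p.
Proof.
move=> kn [s [/allP hs hp]]; exists s; split=> //; apply/allP => c /hs h.
exact: leq_trans kn.
Qed.

Lemma spherical_design_le w k n : (k <= n)%N -> spherical_design n w -> spherical_design k w.
Proof. by move=> kn hw p hp; apply: hw; apply: polyfun_le_widen hp. Qed.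

Lemma exponents_monomial (e : {ffun 'I_d.+1 -> nat}) : exists2 u : seq 'I_d.+1,
  size u = (\sum_i e i)%N & forall x, \prod_i x 0 i ^+ e i = monomial u x.
Proof.
exists (flatten [seq nseq (e i) i | i <- enum 'I_d.+1]).
  rewrite size_flatten /shape -map_comp sumnE big_map big_enum /=.
  by apply: eq_bigr => i _; rewrite size_nseq.
move=> x; rewrite /monomial big_flatten big_map big_enum /=; apply: eq_bigr => i _.
by rewrite big_nseq; elim: (e i) => [|k IH] //=; rewrite exprS IH.
Qed.

Lemma spherical_design_monomials w z n : spherical_design n z ->
  (forall u, (size u <= n)%N -> \sum_a monomial u (w a) = \sum_a monomial u (z a)) ->
  spherical_design n w.
Proof.
move=> zd h p pp; rewrite -(zd p pp); congr (_ * _).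
have [s [/allP hs hp]] := pp.
under eq_bigr do rewrite hp.
under [RHS]eq_bigr do rewrite hp.
rewrite exchange_big [RHS]exchange_big /= !big_seq; apply: eq_bigr => c /hs hc.
rewrite -!mulr_sumr; congr (_ * _).
have [u su hu] := exponents_monomial c.2.
under eq_bigr do rewrite hu.
under [RHS]eq_bigr do rewrite hu.
by apply: h; rewrite su.
Qed.

Lemma antipodal_perm w : injective w -> antipodal w ->
  exists sg : 'I_N -> 'I_N, injective sg /\ forall i, w (sg i) = - w i.
Proof.
move=> wi /choice[sg hsg]; exists sg; split=> // i j ij; apply: wi.
by apply: oppr_inj; rewrite -!hsg ij.
Qed.

Lemma monomialN u x : monomial u (- x) = (-1) ^+ size u * monomial u x.
Proof.
elim: u => [|i u IH]; rewrite /monomial ?big_nil ?mulr1 // !big_cons.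
by rewrite -/(monomial u _) IH mxE /= exprS -/(monomial u x); ring.
Qed.

Lemma antipodal_monomial_odd w u : injective w -> antipodal w -> odd (size u) ->
  \sum_a monomial u (w a) = 0.
Proof.
move=> wi wa uo; have [sg [si hsg]] := antipodal_perm wi wa.
have E : \sum_a monomial u (w a) = - \sum_a monomial u (w a).
  rewrite {1}(reindex sg) /=; last by apply: onW_bij; apply: injF_bij.
  by rewrite -sumrN; apply: eq_bigr => a _; rewrite hsg monomialN -signr_odd uo expr1 mulN1r.
lra.
Qed.

End configurations.

(** * From sharpness to optimality and the equality case *)

Section assembly.
Context {R : realType} {d N : nat}.
Local Notation V := ('rV[R]_d.+1).
Implicit Types (w z : 'I_N -> V) (x : V) (ts s : seq R).

Lemma pd_partial_products z s S : (1 <= d)%N -> (0 < N)%N -> config_on_sphere z ->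
  spherical_design S z -> ((size s).*2 <= S)%N -> pairwise <%R (rcons s 1) ->
  (forall a b, dotp (z a) (z b) \in rcons s 1) ->
  (forall t, t \in rcons s 1 -> 0 < multiplicity z t) ->
  forall j, (j <= size s)%N -> pd_kernel (d := d) (prodXs (take j s)).
Proof.
move=> d1 N0 zS zd sS pw hu l0 j js.
have := @cone_partial_products R (pd_kernel (d := d)) (@pd_kernel0 R d) (@pd_kernelD R d)
  (@pd_kernelZ R d) (multiplicity z) (rcons s 1) pw l0.
have -> : take j s = take j (rcons s 1) by rewrite -cats1 takel_cat.
apply; last by rewrite size_rcons ltnS.
move=> k P; rewrite size_rcons ltnS => ks.
apply: (pd_kernel_orthogonal d1 N0 zS zd pw hu l0 ks).
by rewrite (leq_trans _ sS) // leq_double.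
Qed.

Lemma pairsum_antipodal z p : injective z -> antipodal z ->
  pairsum z (p \Po - 'X) = pairsum z p.
Proof.
move=> zi za; have [sg [si hsg]] := antipodal_perm zi za.
apply: eq_bigr => a _; rewrite [RHS](reindex sg) /=; last by apply: onW_bij; apply: injF_bij.
by apply: eq_bigr => b _; rewrite horner_comp hornerN hornerX hsg dotpNr.
Qed.

Lemma pd_partial_products_antipodal z s S : (1 <= d)%N -> (0 < N)%N -> config_on_sphere z ->
  injective z -> antipodal z ->
  spherical_design S z -> ((size s).*2 <= S)%N -> pairwise <%R (-1 :: rcons s 1) ->
  (forall a b, dotp (z a) (z b) \in -1 :: rcons s 1) ->
  (forall t, t \in -1 :: rcons s 1 -> 0 < multiplicity z t) ->
  forall j, (j <= size s)%N -> pd_kernel (d := d) (prodXs (take j s)).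
Proof.
move=> d1 N0 zS zi za zd sS pw hu l0 j js.
have us : uniq (-1 :: rcons s 1) by apply: pairwise_uniq pw; exact: ltxx.
apply: (@cone_partial_products_symmetric R (pd_kernel (d := d)) (@pd_kernel0 R d) (@pd_kernelD R d)
  (@pd_kernelZ R d) (multiplicity z) s pw l0) => //.
  by move=> p; rewrite -!(pairsumE _ us hu) pairsum_antipodal.
move=> k P ks.
apply: (@pd_kernel_orthogonal _ _ _ _ z d1 N0 zS zd (-1 :: s)) => //=; first exact: leqW.
by rewrite (leq_trans _ sS) // leq_double.
Qed.

(* [e] records whether [-1] is a dot product; [ts] lists the other ones. *)
Definition optimality_certificate z e ts :=
  let ns := if e then -1 :: ts else ts in
  [/\ uniq ts, (forall t, t \in ts -> -1 < t < 1),
    ns =i dot_products z /\ uniq ns, spherical_design (size ns + size ts) z &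
    (forall j, (j <= size ts)%N -> pd_kernel (d := d) (prodXs (take j ts))) /\
    (e -> antipodal z)].

Lemma dot_products_lt1 z t : config_on_sphere z -> injective z -> t \in dot_products z ->
  -1 <= t < 1.
Proof.
move=> zS zi /mem_dot_products[a [b [ab <-]]].
have /andP[-> le1] := dotp_le1 (zS a) (zS b).
rewrite lt_def le1 andbT eq_sym; apply: contra ab => /eqP /(dotp_eq1 (zS a) (zS b)) /zi ->.
exact: eqxx.
Qed.

Lemma optimality_certificate_exists z m : (1 <= d)%N -> config_on_sphere z -> (1 <= m)%N ->
  strongly_m_sharp m z \/ (antipodal z /\ m_sharp m z) ->
  (0 < N)%N /\ exists e ts, optimality_certificate z e ts /\
    size (if e then -1 :: ts else ts) = m.
Proof.
move=> d1 zS m1 hz.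
have [zi [zd zm]] : m_sharp m z by case: hz => [[]|[]].
have N0 : (0 < N)%N.
  case E : (dot_products z) => [|t D]; first by move: m1; rewrite -zm E.
  have : t \in dot_products z by rewrite E mem_head.
  by move=> /mem_dot_products[a _]; exact: leq_ltn_trans (ltn_ord a).
split=> //; set D := dot_products z in zm.
have uD : uniq D by exact: undup_uniq.
pose ts := sort <=%R [seq t <- D | t != -1].
pose e := -1 \in D.
have uts : uniq ts by rewrite sort_uniq filter_uniq.
have mts t : (t \in ts) = (t != -1) && (t \in D) by rewrite mem_sort mem_filter.
have tsI t : t \in ts -> -1 < t < 1.
  rewrite mts => /andP[t1 /(dot_products_lt1 zS zi)/andP[h1 ->]].
  by rewrite lt_def t1 h1.
pose ns := if e then -1 :: ts else ts.
have uns : uniq ns by rewrite /ns; case: (e); rewrite //= uts mts eqxx.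
have nsD : ns =i D.
  move=> t; rewrite /ns; case eE: e; rewrite ?inE mts; first by case: eqVneq => // ->.
  by case: eqVneq => // ->; rewrite -/e eE.
have sns : size ns = m by rewrite -zm; apply/perm_size/uniq_perm.
have dots a b : a != b -> dotp (z a) (z b) \in ns.
  by move=> ab; rewrite nsD; apply/mem_dot_products; exists a, b.
have dots1 a b : dotp (z a) (z b) \in rcons ns 1.
  rewrite mem_rcons inE; have [->|ab] := eqVneq a b; last by rewrite dots ?orbT.
  by rewrite (zS b : dotp (z b) (z b) = 1) eqxx.
have mult t : t \in rcons ns 1 -> 0 < multiplicity z t.
  rewrite mem_rcons inE => /predU1P[->|].
    by rewrite -(zS (Ordinal N0) : dotp _ _ = 1) multiplicity_gt0.
  by rewrite nsD => /mem_dot_products[a [b [_ <-]]]; exact: multiplicity_gt0.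
have pts : pairwise <%R ts.
  by rewrite -(sorted_pairwise lt_trans) sort_lt_sorted filter_uniq.
have pts1 : pairwise <%R (rcons ts 1).
  by rewrite pairwise_rcons pts andbT; apply/allP => t /tsI /andP[].
have N1 : (-1 : R) < 1 by rewrite (lt_trans (ltrN10 R)) // ltr01.
have alt : spherical_design (2 * m) z \/ e /\ antipodal z.
  case: hz => [[_ zd2]|[za _]]; [by left|right; split=> //].
  have [b hb] := za (Ordinal N0); apply/mem_dot_products; exists (Ordinal N0), b.
  have zz : dotp (z (Ordinal N0)) (z (Ordinal N0)) = 1 by exact: zS.
  split; last by rewrite hb dotpNr zz.
  apply/eqP => eb; move: hb; rewrite -eb => hb.
  by move: zz; rewrite {2}hb dotpNr (zS (Ordinal N0) : dotp _ _ = 1); lra.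
(* One antipodal pair and the constant potential make the whole configuration antipodal, so the
   symmetric cone argument also covers the strongly sharp case with dot product -1. *)
have za : e -> antipodal z.
  move=> he; case: alt => [zd2|[] //].
  apply: (antipodal_from_count zS (ts := ts)) => [a b /dots|a]; first by rewrite /ns he.
  have : -1 \in D by [].
  move=> /mem_dot_products[a0 [b0 [_ ab0]]].
  have Nts : -1 \notin ts by rewrite mts eqxx.
  have := count_with_antipode zS ab0 Nts.
  rewrite (design_const d1 zd2 _ (zS a0) (zS a)) // size_prodXs2 addnn ltnS mul2n leq_double -sns /ns he.
  exact: leqnSn.
exists e, ts; split=> //; split=> //.
  case: alt => [zd2|[he _]].
    apply: spherical_design_le zd2; rewrite -/ns sns mul2n -addnn leq_add2l -sns /ns.
    by case: (e) => //=.
  by apply: spherical_design_le zd; rewrite -sns /ns he /=; lia.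
split=> // j js; case he: e.
  move: dots1 mult; rewrite /ns he => dots1 mult.
  apply: (pd_partial_products_antipodal d1 N0 zS zi (za he) zd _ _ dots1 mult) => //.
    by rewrite -sns /ns he /=; lia.
  rewrite /= pts1 andbT; apply/allP => t; rewrite mem_rcons inE => /predU1P[->//|/tsI/andP[]//].
case: alt => [zd2|[]]; last by rewrite he.
move: dots1 mult; rewrite /ns he => dots1 mult.
apply: (pd_partial_products d1 N0 zS zd2 _ pts1 dots1 mult) => //.
by rewrite -sns /ns he mul2n.
Qed.

Section main.
Variables (z : 'I_N -> V) (e : bool) (ts : seq R).
Hypotheses (d1 : (1 <= d)%N) (N0 : (0 < N)%N) (zS : config_on_sphere z).
Hypothesis zi : injective z.
Let ns := if e then -1 :: ts else ts.
Let S := (size ns + size ts)%N.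
Hypotheses (cert : optimality_certificate z e ts) (ns0 : (0 < size ns)%N).

Let uts : uniq ts. Proof. by have [] := cert. Qed.
Let tsI t : t \in ts -> -1 < t < 1. Proof. by have [_ + _ _ _] := cert; apply. Qed.
Let nsD : ns =i dot_products z. Proof. by have [_ _ [] ] := cert. Qed.
Let zd : spherical_design S z. Proof. by have [] := cert. Qed.
Let pdt j : (j <= size ts)%N -> pd_kernel (d := d) (prodXs (take j ts)).
Proof. by have [_ _ _ _ [+ _]] := cert; apply. Qed.
Let S0 : (0 < S)%N. Proof. by rewrite addn_gt0 ns0. Qed.
Let zdots a b : a != b -> dotp (z a) (z b) \in ns.
Proof. by move=> ab; rewrite nsD; apply/mem_dot_products; exists a, b. Qed.

Section config.
Variable f : R -> R.
Hypothesis fc : {within `[0, 4], continuous f}.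

Lemma Qf_optimal_le (c : R) w : completely_monotone_oc (fun t => f t + c) 0 4 ->
  config_on_sphere w ->
  [/\ N%:R * Qf f z <= \sum_a \sum_b f (2 - 2 * dotp (z a) (z b)),
      \sum_a \sum_b f (2 - 2 * dotp (z a) (z b)) <= \sum_a \sum_b f (2 - 2 * dotp (w a) (w b)) &
      \sum_a \sum_b f (2 - 2 * dotp (w a) (w b)) <= N%:R * Qf f w].
Proof.
move=> fcm wS; have hD := dot_profile_derivatives fc fcm.
have h0 k t := @dot_profile_ge0 R f c k t fcm.
split; last exact: energy_le_Qf.
  apply: (Qf_le (Ordinal N0)) => // x xS.
  exact: (potential_le d1 zS zd uts tsI zdots hD h0).
exact: (energy_le d1 zS zd uts tsI S0 zdots pdt hD h0 wS).
Qed.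

Section equality.
Variables (c : R) (w : 'I_N -> V).
Hypotheses (fcm : strictly_completely_monotone_oc (fun t => f t + c) 0 4).
Hypotheses (wS : config_on_sphere w) (wQ : Qf f w = Qf f z).

Let hD := dot_profile_derivatives fc fcm.1.
Let h0 k t := @dot_profile_ge0 R f c k t fcm.1.
Let hpos k t := @dot_profile_gt0 R f c k t fcm.
(** As the two maxima agree, the chain of [Qf_optimal_le] closes up. *)
Let wE : \sum_a \sum_b f (2 - 2 * dotp (w a) (w b)) <= \sum_a \sum_b f (2 - 2 * dotp (z a) (z b)).
Proof.
have [h1 h2 h3] := Qf_optimal_le fcm.1 wS.
have [e1 e2 e3] := Qf_optimal_le fcm.1 zS.
by rewrite (le_trans h3) // wQ (le_trans h1).
Qed.

Lemma equality_dots a b : a != b -> dotp (w a) (w b) \in ns.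
Proof. exact: (energy_equality d1 zS zd uts tsI S0 zdots pdt hD h0 hpos wS wE).2. Qed.

Lemma equality_gap (p : {poly R}) : (size p <= S)%N -> gap z w p = 0.
Proof. exact: (gap_eq0 d1 zS zd uts tsI S0 zdots pdt hD h0 hpos wS wE). Qed.

Lemma equality_monomial u : (size u < S)%N ->
  \sum_a monomial u (w a) = \sum_a monomial u (z a).
Proof. exact: (monomial_sum_eq d1 zS zd uts tsI S0 zdots pdt hD h0 hpos wS wE). Qed.

Lemma equality_potential x (p : {poly R}) : (size p <= S)%N ->
  \sum_a p.[dotp x (w a)] = \sum_a p.[dotp x (z a)].
Proof. exact: (potential_sum_eq d1 zS zd uts tsI S0 zdots pdt hD h0 hpos wS wE). Qed.

Lemma equality_injective : injective w.
Proof.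
move=> a b ab; apply/eqP/negPn/negP => /equality_dots.
rewrite ab (wS b : dotp _ _ = 1) => /(node_lt1 tsI).
by rewrite ltxx andbF.
Qed.

Let Nts : -1 \notin ts. Proof. by apply/negP => /tsI; rewrite ltxx. Qed.

Lemma equality_antipodal : e -> antipodal w.
Proof.
move=> he; apply: (antipodal_from_count wS (ts := ts)) => [a b /equality_dots|a].
  by rewrite /ns he.
have : -1 \in dot_products z by rewrite -nsD /ns he mem_head.
move=> /mem_dot_products[a0 [b0 [_ ab0]]].
have := count_with_antipode zS ab0 Nts.
(* The test polynomial has degree [S - 1], just within reach of [equality_potential]. *)
have sp : (size (prodXs ts * prodXs ts)%R <= S)%N.
  by rewrite size_prodXs2 /S /ns he /= addSn.
by rewrite (design_const d1 zd (leqW sp) (zS a0) (wS a)) -equality_potential.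
Qed.

Lemma equality_dot_products : dot_products w =i ns.
Proof.
move=> t; apply/idP/idP => [/mem_dot_products[a [b [ab <-]]]|tn]; first exact: equality_dots.
have [tE|tts] : (e /\ t = -1) \/ t \in ts.
- by move: tn; rewrite /ns; case: (e) => [|->]; [rewrite inE => /predU1P[->|->]; [left|right]|right].
- have [he t1] := tE; have [b hb] := equality_antipodal he (Ordinal N0).
  have ww : dotp (w (Ordinal N0)) (w (Ordinal N0)) = 1 by exact: wS.
  apply/mem_dot_products; exists (Ordinal N0), b; rewrite t1 hb dotpNr ww; split=> //.
  apply/eqP => eb; move: hb; rewrite -eb => hb.
  by move: ww; rewrite {2}hb dotpNr (wS (Ordinal N0) : dotp _ _ = 1); lra.
apply/negPn/negP => tw.
(* [p] has degree [S - 1], is nonpositive on [-1, 1] and vanishes at 1 and at all nodes but [t]. If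
   [w] misses [t], the energy of [p] is 0 for [w], hence for [z], although [z] attains [t], where
   [p] is negative. *)
pose r := rem t ts; pose A := 1 :: (if e then [:: -1] else [::]) ++ r.
pose p := prodXs A * prodXs r.
have tr : t \notin r by rewrite mem_rem_uniqF.
have /andP[t1 t2] := tsI tts.
have sp : (size p <= S)%N.
  rewrite size_prodXs2 /= size_cat /r size_rem // /S /ns.
  by case: (ts) tts => // t0 ts0 _ /=; case: (e) => /=; lia.
have pE (x : R) : p.[x] = (x - 1) * (if e then x + 1 else 1) * (prodXs r).[x] ^+ 2.
  rewrite /p hornerM !horner_prodXs big_cons big_cat /=.
  by case: (e); rewrite ?big_seq1 ?big_nil ?opprK; ring.
have rE (x : R) : x \in ns -> x != t -> p.[x] = 0.
  rewrite pE /ns /r => xn xt.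
  have [xr|xr] := boolP (x \in rem t ts).
    by rewrite (rootP (_ : root _ x)) ?root_prodXs // expr0n mulr0.
  move: xn xr; rewrite mem_rem_uniq // inE xt /=.
  case: (e) => [|->//]; rewrite inE => /predU1P[->|->//] _.
  by rewrite addNr mulr0 mul0r.
have p1 : p.[1] = 0 by rewrite pE subrr !mul0r.
have wp : pairsum w p = 0.
  rewrite /pairsum big1 // => a _; rewrite big1 // => b _.
  have [->|ab] := eqVneq a b; first by rewrite (wS b : dotp _ _ = 1).
  apply: rE; first exact: equality_dots.
  by apply: contra tw => /eqP <-; apply/mem_dot_products; exists a, b.
have pz a b : p.[dotp (z a) (z b)] <= 0.
  have /andP[h1 h2] := dotp_le1 (zS a) (zS b).
  rewrite pE mulr_le0_ge0 ?sqr_ge0 // mulr_le0_ge0 ?subr_le0 //.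
  by case: (e) => //; rewrite -[1]opprK subr_ge0.
have [a [b [_ ab]]] : exists a b, a != b /\ dotp (z a) (z b) = t.
  by apply/mem_dot_products; rewrite -nsD.
have zp : pairsum z p = 0.
  by have := equality_gap sp; rewrite /gap wp sub0r => /eqP; rewrite oppr_eq0 => /eqP.
move: zp => /eqP; rewrite -oppr_eq0 /pairsum -sumrN.
rewrite psumr_eq0 => [/allP /(_ a (mem_index_enum _))|a' _]; last first.
  by rewrite oppr_ge0; apply: sumr_le0 => b' _; exact: pz.
rewrite /= oppr_eq0 -oppr_eq0 -sumrN.
rewrite psumr_eq0 => [/allP /(_ b (mem_index_enum _))|b' _]; last by rewrite oppr_ge0.
rewrite /= oppr_eq0 ab pE !mulf_eq0 orbb -/(root _ _) root_prodXs (negPf tr) orbF.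
rewrite subr_eq0 (lt_eqF t2) /=; case: (e); last by rewrite oner_eq0.
by rewrite -[1]opprK subr_eq0 (gt_eqF t1).
Qed.

Lemma equality_sharp m : size ns = m -> spherical_design (2 * m - 1) z -> sharp w.
Proof.
move=> sns zdm; exists m; split; first exact: equality_injective.
split; last first.
  rewrite -sns; apply/perm_size/uniq_perm; first exact: undup_uniq.
    by have [_ _ []] := cert.
  exact: equality_dot_products.
apply: (spherical_design_monomials zdm) => u su.
have [uS|uS] := ltnP (size u) S; first exact: equality_monomial.
(* The only degree left is [2 * m - 1], which occurs when -1 is a node; both sums then vanish by
   antipodality. *)
have [he uo] : e /\ odd (size u).
  move: su uS ns0; rewrite /S -sns /ns; case: (e) => /=; last by move=> h1 h2 h3; exfalso; lia.
  move=> h1 h2 _; split=> //; suff -> : size u = (size ts).*2.+1 by rewrite /= odd_double.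
  by lia.
have za : antipodal z by have [_ _ _ _ [_ ]] := cert; apply.
by rewrite !antipodal_monomial_odd //; [exact: equality_injective|exact: equality_antipodal].
Qed.

End equality.
End config.
End main.
End assembly.

Theorem theorem2p5 (R : realType) (d N : nat) (f : R -> R)
  (wbar : 'I_N -> 'rV[R]_d.+1) :
  (1 <= d)%N ->
  {within `[0, 4], continuous f} ->
  (exists c : R, completely_monotone_oc (fun t => f t + c) 0 4) ->
  config_on_sphere wbar ->
  ((exists m, (1 <= m)%N /\ strongly_m_sharp m wbar) \/
   (exists m, (1 <= m)%N /\ antipodal wbar /\ m_sharp m wbar)) ->
  (forall w : 'I_N -> 'rV[R]_d.+1, config_on_sphere w -> Qf f wbar <= Qf f w) /\
  ((exists c : R, strictly_completely_monotone_oc (fun t => f t + c) 0 4) ->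
   forall w : 'I_N -> 'rV[R]_d.+1, config_on_sphere w ->
     Qf f w = Qf f wbar ->
     sharp w /\ dot_products w =i dot_products wbar).
Proof.
move=> d1 fc [c fcm] zS hz.
have [m [m1 hm]] : exists m, (1 <= m)%N /\
    (strongly_m_sharp m wbar \/ antipodal wbar /\ m_sharp m wbar).
  by case: hz => [[m [m1 h]]|[m [m1 h]]]; exists m; split=> //; [left|right].
have [zi [zdm _]] : m_sharp m wbar by case: hm => [[]|[]].
have [N0 [e [ts [cert sns]]]] := optimality_certificate_exists d1 zS m1 hm.
have ns0 : (0 < size (if e then -1 :: ts else ts)%R)%N by rewrite sns.
split=> [w wS|[c' fcs] w wS wQ].
  have [h1 h2 h3] := Qf_optimal_le d1 N0 zS cert ns0 fc fcm wS.
  by rewrite -(ler_pM2l (x := N%:R)) ?ltr0n // (le_trans h1) // (le_trans h2).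
split; first exact: (equality_sharp d1 N0 zS zi cert ns0 fc fcs wS wQ sns zdm).
move=> t; rewrite (equality_dot_products d1 N0 zS cert ns0 fc fcs wS wQ).
by have [_ _ [h _] _ _] := cert; exact: h.
Qed.
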